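(* Let $T$ be a first-order theory. If $T$ is finitely coordinatized by a set $\mathcal P$ of types all of which are rosy, then $T$ is rosy.
   Context: We work in a monster model $\mathcal C^{eq}$ of $T$; tuples may be tuples of imaginaries. Strong dividing: a formula $\delta(x,a)$ strongly divides over $A$ if $tp(a/A)$ is non-algebraic and $\{\delta(x,a')\}_{a'\models tp(a/A)}$ is $k$-inconsistent for some $k\in\mathbb N$. Thorn-dividing (written þ-dividing): $\delta(x,a)$ thorn-divides over $A$ if there is a tuple $c$ such that $\delta(x,a)$ strongly divides over $Ac$. Thorn-forking: a formula thorn-forks over $A$ if it implies a finite disjunction of formulas each of which thorn-divides over $A$; a type thorn-divides (thorn-forks) over $A$ if it contains (implies) a formula that does. Thorn-rank: given a formula $\phi$, a finite set $\Delta$ of formulas in variables $x;y$, a finite set $\Pi$ of formulas in variables $y;z$ ($z$ possibly of infinite length), and a number $k$, define $\operatorname{th}(\phi,\Delta,\Pi,k)$ inductively: (1) it is $\ge 0$ if $\phi$ is consistent; (2) for $\lambda$ limit it is $\ge\lambda$ iff it is $\ge\alpha$ for all $\alpha<\lambda$; (3) it is $\ge\alpha+1$ iff there are $\delta\in\Delta$, $\pi(y;z)\in\Pi$ and parameters $c$ such that (a) $\operatorname{th}(\phi\wedge\delta(x,a),\Delta,\Pi,k)\ge\alpha$ for infinitely many $a\models\pi(y;c)$, and (b) $\{\delta(x,a)\}_{a\models\pi(y;c)}$ is $k$-inconsistent. A theory is rosy if all of its thorn-ranks are defined (i.e. ordinal-valued). Rosy type: a type $p$ is rosy if all of its extensions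 satisfy local character for thorn-forking, i.e. for every complete type $q\supseteq p$ over a set $B$ there is $B_0\subseteq B$ with $|B_0|\le|T|$ such that $q$ does not thorn-fork over $B_0$. Coordinatization: $T$ is finitely coordinatized by a set of types $\mathcal P$ if $\mathcal P$ is closed under automorphisms and for every tuple $a$ there are $n\in\omega$ and a sequence $a_0,\dots,a_n$ with $a_0=\emptyset$, $a_n=a$ and $tp(a_i/a_{i-1})\in\mathcal P$ for each $1\le i\le n$. *)

(* Defs.v *)
From mathcomp Require Import all_boot.
From mathcomp Require Import boolp classical_sets functions cardinality.
Set Implicit Arguments.
Unset Strict Implicit.
Unset Printing Implicit Defensive.

Local Open Scope classical_set_scope.
Local Open Scope card_scope.

(** Formulas live in a context of sorted free variables.  The variables of a
    [ctx] may form any type, so infinite tuples of variables are allowed; an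
    [fctx] is a finite tuple of variables.  One-sorted logic is the case
    [lsort L = unit]. *)

Record ctx (S : Type) := Ctx { cvar : Type; csort : cvar -> S }.
Arguments Ctx {S} cvar csort.

Record fctx (S : Type) := FCtx { fsize : nat; fsort : 'I_fsize -> S }.
Arguments FCtx {S} fsize fsort.

Definition ctx_of_fctx (S : Type) (x : fctx S) : ctx S :=
  Ctx 'I_(fsize x) (@fsort S x).
Coercion ctx_of_fctx : fctx >-> ctx.

Definition fctx0 (S : Type) : fctx S :=
  FCtx 0 (fun i : 'I_0 => False_rect S (notF (ltn_ord i))).

Definition map_fctx (S S' : Type) (h : S -> S') (x : fctx S) : fctx S' :=
  FCtx (fsize x) (fun i => h (fsort i)).

Definition cat_ctx (S : Type) (G D : ctx S) : ctx S :=
  Ctx (cvar G + cvar D)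
    (fun v => match v with inl x => csort x | inr y => csort y end).

Definition ext_ctx (S : Type) (G : ctx S) (s : S) : ctx S :=
  Ctx (option (cvar G))
    (fun v => match v with Some x => csort x | None => s end).

Record language := Language {
  lsort : Type;
  lfun : Type;
  fdom : lfun -> fctx lsort;
  fcod : lfun -> lsort;
  lrel : Type;
  rdom : lrel -> fctx lsort }.

Section Syntax.
Variable L : language.

Inductive term (G : ctx (lsort L)) : lsort L -> Type :=
| Var (v : cvar G) : term G (csort v)
| App (f : lfun L) (args : forall i : 'I_(fsize (fdom f)), term G (fsort i)) :
    term G (fcod f).

Inductive formula (G : ctx (lsort L)) : Type :=
| Bot
| Equal (s : lsort L) (t u : term G s)
| Rel (r : lrel L) (args : forall i : 'I_(fsize (rdom r)), term G (fsort i))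
| Neg (p : formula G)
| And (p q : formula G)
| Ex (s : lsort L) (p : formula (ext_ctx G s)).

Definition theory := set (formula (fctx0 (lsort L))).

Fixpoint tsubst (G D : ctx (lsort L)) (h : forall v : cvar G, term D (csort v))
    (s : lsort L) (t : term G s) : term D s :=
  match t with
  | Var v => h v
  | App f args => App (fun i => tsubst h (args i))
  end.

Definition lift_subst (G D : ctx (lsort L))
    (h : forall v : cvar G, term D (csort v)) (s : lsort L)
    (v : cvar (ext_ctx G s)) : term (ext_ctx D s) (csort v) :=
  match v with
  | Some x => tsubst (fun w : cvar D => @Var (ext_ctx D s) (Some w)) (h x)
  | None => @Var (ext_ctx D s) None
  end.

Fixpoint fsubst (G D : ctx (lsort L)) (h : forall v : cvar G, term D (csort v))
    (p : formula G) : formula D :=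
  match p with
  | Bot => Bot D
  | Equal s t u => Equal (tsubst h t) (tsubst h u)
  | Rel r args => Rel (fun i => tsubst h (args i))
  | Neg p => Neg (fsubst h p)
  | And p q => And (fsubst h p) (fsubst h q)
  | Ex s p => Ex (fsubst (lift_subst h (s := s)) p)
  end.

End Syntax.
Arguments Var {L G} v.

Record structure (L : language) := Structure {
  car :> lsort L -> Type;
  fint : forall f : lfun L,
    (forall i : 'I_(fsize (fdom f)), car (fsort i)) -> car (fcod f);
  rint : forall r : lrel L,
    (forall i : 'I_(fsize (rdom r)), car (fsort i)) -> Prop }.

(** [asg N G]: tuples of elements of [N] of the length and sorts given by [G]. *)
Definition asg (L : language) (N : structure L) (G : ctx (lsort L)) :=
  forall v : cvar G, N (csort v).

Definition cat_asg (L : language) (N : structure L) (G D : ctx (lsort L))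
    (a : asg N G) (b : asg N D) : asg N (cat_ctx G D) :=
  fun v => match v with inl x => a x | inr y => b y end.

Definition ext_asg (L : language) (N : structure L) (G : ctx (lsort L))
    (s : lsort L) (a : asg N G) (m : N s) : asg N (ext_ctx G s) :=
  fun v => match v with Some x => a x | None => m end.

Fixpoint eval (L : language) (N : structure L) (G : ctx (lsort L))
    (a : asg N G) (s : lsort L) (t : term G s) : N s :=
  match t with
  | Var v => a v
  | App f args => fint (fun i => eval a (args i))
  end.

Fixpoint sat (L : language) (N : structure L) (G : ctx (lsort L))
    (p : formula G) (a : asg N G) : Prop :=
  match p with
  | Bot => False
  | Equal s t u => eval a t = eval a u
  | Rel r args => rint (fun i => eval a (args i))
  | Neg p => ~ sat p a
  | And p q => sat p a /\ sat q a
  | Ex s p => exists m : N s, sat p (ext_asg a m)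
  end.

Definition asg0 (L : language) (N : structure L) : asg N (fctx0 (lsort L)) :=
  fun i : 'I_0 => False_rect _ (notF (ltn_ord i)).

Definition models (L : language) (N : structure L) (T : theory L) :=
  forall p, T p -> sat p (asg0 N).

Record automorphism (L : language) (N : structure L) := Automorphism {
  aut :> forall s : lsort L, N s -> N s;
  aut_bij : forall s, bijective (@aut s);
  aut_fn : forall (f : lfun L) (a : asg N (fdom f)),
    aut (fint a) = fint (fun i => aut (a i));
  aut_rel : forall (r : lrel L) (a : asg N (rdom r)),
    rint (fun i => aut (a i)) <-> rint a }.

Arguments aut {L N} _ s _.

Section Types.
Variables (L : language) (N : structure L).
Local Notation fctx := (fctx (lsort L)).

Definition elem := {s : lsort L & N s}.
Definition elem_of (s : lsort L) (m : N s) : elem := existT _ s m.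

Definition entries (G : ctx (lsort L)) (a : asg N G) : set elem :=
  range (fun v => elem_of (a v)).

Definition elem_ctx : ctx (lsort L) := Ctx elem (fun e => projT1 e).

(** Formulas in the variables [G] with parameters in [N]: each element of [N] is
    a further variable, which is always interpreted by itself. *)
Definition lformula (G : ctx (lsort L)) := formula (cat_ctx G elem_ctx).

Definition lsat (G : ctx (lsort L)) (p : lformula G) (b : asg N G) :=
  sat p (@cat_asg L N G elem_ctx b (fun e => projT2 e)).

Definition inst_subst (G D : ctx (lsort L)) (a : asg N D)
    (v : cvar (cat_ctx G D)) : term (cat_ctx G elem_ctx) (csort v) :=
  match v with
  | inl x => @Var L (cat_ctx G elem_ctx) (inl x)
  | inr y => @Var L (cat_ctx G elem_ctx) (inr (elem_of (a y)))
  end.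

(** [inst d a] is the formula d(x,a) obtained from d(x;y). *)
Definition inst (G D : ctx (lsort L)) (d : formula (cat_ctx G D)) (a : asg N D) :
    lformula G :=
  fsubst (inst_subst (G := G) a) d.

Definition is_over (A : set elem) (G : ctx (lsort L)) (p : lformula G) :=
  exists (y : fctx) (d : formula (cat_ctx G y)) (a : asg N y),
    entries a `<=` A /\ p = inst d a.

Definition move_subst (G : ctx (lsort L)) (s : automorphism N)
    (v : cvar (cat_ctx G elem_ctx)) : term (cat_ctx G elem_ctx) (csort v) :=
  match v with
  | inl x => @Var L (cat_ctx G elem_ctx) (inl x)
  | inr e => @Var L (cat_ctx G elem_ctx) (inr (elem_of (s _ (projT2 e))))
  end.

Definition move (G : ctx (lsort L)) (s : automorphism N) (p : lformula G) :
    lformula G :=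
  fsubst (move_subst s) p.

Definition realizes (G : ctx (lsort L)) (p : set (lformula G)) (b : asg N G) :=
  forall f, p f -> lsat f b.

Definition finitely_satisfiable (G : ctx (lsort L)) (p : set (lformula G)) :=
  forall F, F `<=` p -> finite_set F -> exists b, realizes F b.

Definition partial_type (A : set elem) (x : fctx) (p : set (lformula x)) :=
  p `<=` @is_over A x /\ finitely_satisfiable p.

Definition complete_type (A : set elem) (x : fctx) (p : set (lformula x)) :=
  partial_type A p /\ forall f, @is_over A x f -> p f \/ p (Neg f).

Definition tp (G : ctx (lsort L)) (a : asg N G) (A : set elem) :
    set (lformula G) :=
  [set f | is_over A f /\ lsat f a].

Definition ftuple := {x : fctx & asg N x}.
Definition ftuple0 : ftuple := existT _ (fctx0 (lsort L)) (asg0 N).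

End Types.

Definition small (kappa X : Type) (A : set X) :=
  A #<= [set: kappa] /\ ~ ([set: kappa] #<= A).

(** A type whose cardinality is |T| = |L| + aleph_0. *)
Definition all_formulas (L : language) := {x : fctx (lsort L) & formula x}.

Definition saturated (L : language) (kappa : Type) (M : structure L) :=
  forall (A : set (elem M)) (x : fctx (lsort L)) (p : set (lformula M x)),
    small kappa A -> partial_type A p -> exists b, realizes p b.

Definition strongly_homogeneous (L : language) (kappa : Type)
    (M : structure L) :=
  forall (G : ctx (lsort L)) (a b : asg M G),
    small kappa [set: cvar G] ->
    (forall p : formula G, sat p a <-> sat p b) ->
    exists s : automorphism M, forall v, s _ (a v) = b v.

(** "Small" means of cardinality smaller than [kappa]; that [kappa] is
    sufficiently large is rendered by 2^|T| < kappa. *)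
Definition monster_model (L : language) (T : theory L) (kappa : Type)
    (M : structure L) :=
  [/\ small kappa [set: set (all_formulas L)],
      models M T, saturated kappa M & strongly_homogeneous kappa M].

Section Imaginaries.
Variables (L : language) (M : structure L).

Record def_equiv := DefEquiv {
  eq_ctx : fctx (lsort L);
  eq_fml : formula (cat_ctx eq_ctx eq_ctx);
  eq_rel := fun a b : asg M eq_ctx => sat eq_fml (cat_asg a b);
  eq_refl : forall a, eq_rel a a;
  eq_sym : forall a b, eq_rel a b -> eq_rel b a;
  eq_trans : forall a b c, eq_rel a b -> eq_rel b c -> eq_rel a c }.

(** [inl s] are the home sorts; [inr E] is the sort of E-classes, and the
    function symbol [inr E] is the canonical projection onto it. *)
Definition Leq : language := {|
  lsort := lsort L + def_equiv;
  lfun := lfun L + def_equiv;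
  fdom f := match f with
            | inl g => map_fctx inl (fdom g)
            | inr E => map_fctx inl (eq_ctx E)
            end;
  fcod f := match f with
            | inl g => inl (fcod g)
            | inr E => inr E
            end;
  lrel := lrel L;
  rdom r := map_fctx inl (rdom r) |}.

Definition eq_car (s : lsort Leq) : Type :=
  match s with
  | inl s => M s
  | inr E => {C : set (asg M (eq_ctx E)) | exists a, C = [set b | eq_rel a b]}
  end.

Definition class_of (E : def_equiv) (a : asg M (eq_ctx E)) : eq_car (inr E) :=
  exist _ [set b | eq_rel a b] (ex_intro _ a erefl).

Definition Meq : structure Leq := {|
  car := eq_car;
  fint f := match f return
      (forall i : 'I_(fsize (fdom (l := Leq) f)), eq_car (fsort i)) ->
      eq_car (fcod (l := Leq) f) with
    | inl g => fun a => @fint L M g a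
    | inr E => fun a => class_of (E := E) a
    end;
  rint r := fun a => @rint L M r a |}.

End Imaginaries.

Section Thorn.
Variables (L : language) (N : structure L).
Local Notation fctx := (fctx (lsort L)).

Definition k_inconsistent (G D : ctx (lsort L)) (d : formula (cat_ctx G D))
    (k : nat) (Y : set (asg N D)) :=
  forall a : 'I_k -> asg N D, injective a -> (forall i, Y (a i)) ->
    ~ exists b : asg N G, forall i, sat d (cat_asg b (a i)).

Definition strongly_divides (x y : fctx) (d : formula (cat_ctx x y))
    (a : asg N y) (A : set (elem N)) :=
  infinite_set [set a' | realizes (tp a A) a'] /\
  exists k, k_inconsistent d k [set a' | realizes (tp a A) a'].

Definition thorn_divides (x y : fctx) (d : formula (cat_ctx x y))
    (a : asg N y) (A : set (elem N)) :=
  exists (z : fctx) (c : asg N z), strongly_divides d a (A `|` entries c).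

Definition thorn_forks (x : fctx) (p : lformula N x) (A : set (elem N)) :=
  exists (n : nat) (y : 'I_n -> fctx) (d : forall i, formula (cat_ctx x (y i)))
      (a : forall i, asg N (y i)),
    (forall i, thorn_divides (d i) (a i) A) /\
    (forall b, lsat p b -> exists i, lsat (inst (d i) (a i)) b).

Definition type_thorn_forks (x : fctx) (q : set (lformula N x))
    (A : set (elem N)) :=
  exists p : lformula N x,
    (forall b, realizes q b -> lsat p b) /\ thorn_forks p A.

End Thorn.

(** An ordinal is presented as an element [w] of a well-order [W]. *)
Record well_order := WellOrder {
  wo_car :> Type;
  wo_lt : wo_car -> wo_car -> Prop;
  wo_trans : forall u v w, wo_lt u v -> wo_lt v w -> wo_lt u w;
  wo_total : forall v w, [\/ wo_lt v w, v = w | wo_lt w v];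
  wo_wf : well_founded wo_lt }.

Section ThornRank.
Variables (L : language) (N : structure L).

Definition is_zero (W : well_order) (w : W) := ~ exists v, wo_lt v w.

Definition is_succ (W : well_order) (v w : W) :=
  wo_lt v w /\ ~ exists u, wo_lt v u /\ wo_lt u w.

Definition is_limit (W : well_order) (w : W) :=
  ~ is_zero w /\ ~ exists v, is_succ v w.

Definition consistent (x : fctx (lsort L)) (p : lformula N x) :=
  exists b, lsat p b.

Section Rank.
Variables (x y : fctx (lsort L)) (z : ctx (lsort L)).
Variables (Delta : set (formula (cat_ctx x y))).
Variables (Pi : set (formula (cat_ctx y z))) (k : nat).

(** [R] stands for the set of formulas of rank at least alpha; the result is the
    set of formulas of rank at least alpha + 1. *)
Definition rank_step (R : set (lformula N x)) (p : lformula N x) :=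
  exists (d : formula (cat_ctx x y)) (pi : formula (cat_ctx y z)) (c : asg N z),
    [/\ Delta d, Pi pi,
        infinite_set [set a : asg N y | sat pi (cat_asg a c) /\
                                        R (And p (inst d a))] &
        k_inconsistent d k [set a : asg N y | sat pi (cat_asg a c)]].

Definition rank_clauses (W : well_order) (w : W)
    (R : forall v : W, wo_lt v w -> set (lformula N x)) (p : lformula N x) :=
  [\/ is_zero w /\ consistent p,
      is_limit w /\ forall v (vw : wo_lt v w), R v vw p |
      exists (v : W) (vw : wo_lt v w), is_succ v w /\ rank_step (R v vw) p].

Definition rank_ge (W : well_order) : W -> set (lformula N x) :=
  Fix (@wo_wf W) (fun _ => set (lformula N x)) (@rank_clauses W).

Definition rank_defined (p : lformula N x) :=
  exists (W : well_order) (w : W), ~ rank_ge w p.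

End Rank.
End ThornRank.

Definition rosy_theory (L : language) (M : structure L) :=
  forall (x y : fctx (lsort (Leq M))) (z : ctx (lsort (Leq M)))
      (Delta : set (formula (cat_ctx x y))) (Pi : set (formula (cat_ctx y z)))
      (k : nat) (p : lformula (Meq M) x),
    finite_set Delta -> finite_set Pi -> rank_defined Delta Pi k p.

Definition is_type (L : language) (kappa : Type) (M : structure L)
    (x : fctx (lsort (Leq M))) (p : set (lformula (Meq M) x)) :=
  exists2 A : set (elem (Meq M)), small kappa A & partial_type A p.

Definition rosy_type (L : language) (kappa : Type) (M : structure L)
    (x : fctx (lsort (Leq M))) (p : set (lformula (Meq M) x)) :=
  forall (B : set (elem (Meq M))) (q : set (lformula (Meq M) x)),
    small kappa B -> complete_type B q -> p `<=` q ->
    exists B0, [/\ B0 `<=` B, B0 #<= [set: all_formulas L] &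
                   ~ type_thorn_forks q B0].

Definition finitely_coordinatized (L : language) (M : structure L)
    (P : forall x : fctx (lsort (Leq M)), set (set (lformula (Meq M) x))) :=
  (forall (s : automorphism (Meq M)) x p, P x p -> P x (move s @` p)) /\
  (forall a : ftuple (Meq M), exists (n : nat) (t : nat -> ftuple (Meq M)),
     [/\ t 0 = ftuple0 (Meq M), t n = a &
         forall i, i < n ->
           P (projT1 (t i.+1)) (tp (projT2 (t i.+1)) (entries (projT2 (t i))))]).

(* Main.v *)
Require Import Defs.
From Stdlib Require List.
From Stdlib Require Import Eqdep.
From mathcomp Require Import all_boot.
From mathcomp Require Import boolp classical_sets functions cardinality.
From mathcomp Require wochoice.

(** If a thorn-rank is undefined, compactness yields a long chain of pairs
    (a_i, c_i) and one b such that a_i is algebraic over b c_i, uniformly, but not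
    over c_i and the earlier pairs.  Coordinatize b by t_0 = (), ..., t_n = b.  By
    rosiness tp(t_(m+1) / B t_m), where B collects the chain, does not thorn-fork
    over some set of size at most |T|.  The chain is so long that some j lies above
    all the indices occurring in these sets.  Then a_j is algebraic over t_n, c_j
    and the pairs below j, and this descends from t_(m+1) to t_m: otherwise the
    formula witnessing algebraicity would strongly divide.  At t_0 this contradicts
    the choice of the chain. *)

Set Implicit Arguments.
Unset Strict Implicit.
Unset Printing Implicit Defensive.

Local Open Scope classical_set_scope.
Local Open Scope card_scope.

(** * Definable sets *)

(** What constrains the proof is the length of the chain. Some index must lie above any family of at
    most |T| indices, and above finitely many such families, however many steps the coordinatization
    of b turns out to take; yet the chain must have at most 2^|T| entries, since compactness comes
    from saturation below [kappa] and rosiness of a type concerns small sets B only. Length |T|^+ is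
    the classical choice; here the indices are well-founded trees, which meet both demands without
    cardinal arithmetic.

    The chain exists because an undefined rank leaves a set of consistent formulas, each with
    infinitely many refinements in that set: finitely many algebraic conditions exclude finitely
    many a, and k-inconsistency leaves, for a given c, fewer than k of them compatible with any one
    b.

    Choosing j above the indices puts every base B0 inside t_m together with c_j and the earlier
    pairs. The two halves of strong dividing then come from the two sides of the descent:
    non-algebraicity over t_m gives infinitely many conjugates of the parameter, and the bound on
    solutions over t_(m+1) gives k-inconsistency. *)

Lemma dep_choice (X : Type) (U : X -> Type) (Q : forall x, U x -> Prop) :
  (forall x, exists y, Q x y) -> exists f : forall x, U x, forall x, Q x (f x).
Proof. by move=> h; exists (fun x => sval (cid (h x))) => x; case: cid. Qed.

Lemma In_tnth (X : Type) (l : seq X) (v : X) :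
  List.In v l -> exists i, v = tnth (in_tuple l) i.
Proof.
elim: l => //= w l IH [->|/IH [i ->]].
  by exists ord0; rewrite (tnth_nth v).
exists (lift ord0 i); rewrite !(tnth_nth v) /= .
by [].
Qed.

Lemma tnth_In (X : Type) (l : seq X) (i : 'I_(size l)) :
  List.In (tnth (in_tuple l) i) l.
Proof.
elim: l i => [[] //|w l IH i]; rewrite (tnth_nth w).
case: (unliftP ord0 i) => [j ->|->] /=; last by left.
by right; have := IH j; rewrite (tnth_nth w).
Qed.

Lemma finite_list (X : Type) (A : set X) :
  finite_set A -> exists l : seq X, A = [set x | List.In x l].
Proof.
move=> /(@finite_seqP {classic X}) [s ->]; exists s.
apply/seteqP; split => x /=.
  by elim: s => //= y s IH; rewrite inE => /orP[/eqP ->|/IH]; [left|right].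
by elim: s => //= y s IH [->|/IH]; rewrite inE ?eqxx // => ->; rewrite orbT.
Qed.

Lemma list_finite (X : Type) (l : seq X) : finite_set [set x | List.In x l].
Proof.
elim: l => [|y l IH].
  by rewrite (_ : [set _ | _] = set0) //; apply/seteqP; split.
rewrite (_ : [set _ | _] = [set y] `|` [set x | List.In x l]).
  by rewrite finite_setU; split => //; apply: finite_set1.
by apply/seteqP; split => x /= [->|]; by [left|right].
Qed.

Section Substitution.
Variables (L : language) (N : structure L).
Implicit Types G D : ctx (lsort L).

Lemma eval_tsubst G D (h : forall v : cvar G, term D (csort v)) s
    (t : term G s) (a : asg N D) :
  eval a (tsubst h t) = eval (fun v => eval a (h v)) t.
Proof. by elim: t => //= f args IH; congr fint; apply: functional_extensionality_dep. Qed.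

Lemma eval_lift_subst G D (h : forall v : cvar G, term D (csort v)) s
    (a : asg N D) (m : N s) :
  (fun v => eval (ext_asg a m) (lift_subst h (s := s) v)) =
  ext_asg (fun v => eval a (h v)) m.
Proof.
by apply: functional_extensionality_dep => -[v|] //=; rewrite eval_tsubst.
Qed.

Lemma sat_fsubst G (p : formula G) : forall D
    (h : forall v : cvar G, term D (csort v)) (a : asg N D),
  sat (fsubst h p) a <-> sat p (fun v => eval a (h v)).
Proof.
elim: p => {G} /= [G|G s t u|G r args|G p IH|G p IHp q IHq|G s p IH] D h a.
- by [].
- by rewrite !eval_tsubst.
- rewrite (_ : (fun i => _) = fun i => eval (fun v => eval a (h v)) (args i)) //.
  by apply: functional_extensionality_dep => i; rewrite eval_tsubst.
- by rewrite IH.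
- by rewrite IHp IHq.
- split=> -[m] => [/IH|hm]; first by rewrite eval_lift_subst => hm; exists m.
  by exists m; apply/IH; rewrite eval_lift_subst.
Qed.

(** From here on sets of assignments replace formulas: renaming variables becomes precomposition
    with a map given by terms ([is_subst]), and no syntactic substitution has to be computed. *)
Definition definable G (X : set (asg N G)) :=
  exists p : formula G, forall a, sat p a <-> X a.

Lemma definable_ext G (X Y : set (asg N G)) :
  (forall a, X a <-> Y a) -> definable X -> definable Y.
Proof. by move=> XY [p hp]; exists p => a; rewrite hp. Qed.

Lemma definable_sat G (p : formula G) : definable (sat (N := N) p).
Proof. by exists p. Qed.

Lemma definable_not G (X : set (asg N G)) :
  definable X -> definable (fun a => ~ X a).
Proof. by move=> [p hp]; exists (Neg p) => a /=; rewrite hp. Qed.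

Lemma definable_and G (X Y : set (asg N G)) :
  definable X -> definable Y -> definable (fun a => X a /\ Y a).
Proof. by move=> [p hp] [q hq]; exists (And p q) => a /=; rewrite hp hq. Qed.

Lemma definable_false G : definable (fun _ : asg N G => False).
Proof. by exists (Bot G). Qed.

Lemma definable_true G : definable (fun _ : asg N G => True).
Proof. by apply: definable_ext (definable_not (definable_false G)) => a; split=> // _ []. Qed.

Lemma definable_all_in G (I : Type) (l : seq I) (X : I -> set (asg N G)) :
  (forall i, List.In i l -> definable (X i)) ->
  definable (fun a => forall i, List.In i l -> X i a).
Proof.
elim: l => [_|i l IH dX].
  by apply: definable_ext (definable_true G) => a.
have dXi := dX i (or_introl erefl).
apply: definable_ext (definable_and dXi (IH (fun j hj => dX j (or_intror hj)))).
move=> a; split=> [[h1 h2] j [<- //|/h2 //]|h].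
by split=> [|j hj]; apply: h; [left|right].
Qed.

Lemma definable_ex_in G (I : Type) (l : seq I) (X : I -> set (asg N G)) :
  (forall i, List.In i l -> definable (X i)) ->
  definable (fun a => exists2 i, List.In i l & X i a).
Proof.
move=> dX.
have dN i : List.In i l -> definable (fun a => ~ X i a).
  by move=> /dX; apply: definable_not.
apply: definable_ext (definable_not (definable_all_in dN)) => a.
split=> [/existsNP [i /not_implyP [hi /contrapT hX]]|[i hi hX] /(_ i hi)] //.
by exists i.
Qed.

Definition is_term G s (f : asg N G -> N s) :=
  exists t : term G s, forall a, eval a t = f a.

Lemma is_term_var G (v : cvar G) : is_term (fun a => a v).
Proof. by exists (Var v). Qed.

Definition is_subst G D (r : asg N D -> asg N G) :=
  forall v, is_term (fun a => r a v).

Lemma definable_subst G D (X : set (asg N G)) (r : asg N D -> asg N G) :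
  is_subst r -> definable X ->
  definable (fun a => X (r a)).
Proof.
move=> /dep_choice [h hh] [p hp]; exists (fsubst h p) => a.
rewrite sat_fsubst hp (_ : (fun v => _) = r a) //.
by apply: functional_extensionality_dep => v; rewrite hh.
Qed.

Lemma definable_eq G s (f g : asg N G -> N s) : is_term f -> is_term g ->
  definable (fun a => f a = g a).
Proof. by move=> [t ht] [u hu]; exists (Equal t u) => a /=; rewrite ht hu. Qed.

Definition lasg G D (c : asg N (cat_ctx G D)) : asg N G := fun v => c (inl v).
Definition rasg G D (c : asg N (cat_ctx G D)) : asg N D := fun v => c (inr v).

Lemma is_subst_id G : is_subst (fun a : asg N G => a).
Proof. exact: is_term_var. Qed.

Lemma is_subst_lasg G D E (r : asg N E -> asg N (cat_ctx G D)) :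
  is_subst r -> is_subst (fun a => lasg (r a)).
Proof. by move=> hr v; apply: (hr (inl v)). Qed.

Lemma is_subst_rasg G D E (r : asg N E -> asg N (cat_ctx G D)) :
  is_subst r -> is_subst (fun a => rasg (r a)).
Proof. by move=> hr v; apply: (hr (inr v)). Qed.

Lemma is_subst_cat G D E (r : asg N E -> asg N G) (r' : asg N E -> asg N D) :
  is_subst r -> is_subst r' -> is_subst (fun a => cat_asg (r a) (r' a)).
Proof. by move=> hr hr' [v|v]; [exact: hr|exact: hr']. Qed.

End Substitution.

#[local] Hint Resolve is_subst_id is_subst_lasg is_subst_rasg is_subst_cat : core.

(** * Finite supports and projections *)

Section Support.
Variables (L : language) (N : structure L).
Implicit Types G D : ctx (lsort L).

Lemma update_exists G (a : asg N G) (u : cvar G) (m : N (csort u)) :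
  exists a' : asg N G, a' u = m /\ forall v, v <> u -> a' v = a v.
Proof.
have /dep_choice [a' ha'] (v : cvar G) : exists y : N (csort v),
    (v <> u -> y = a v) /\
    (forall e : u = v, y = eq_rect u (fun w => N (csort w)) m v e).
  have [uv|uv] := pselect (u = v); last by exists (a v); split=> // e; case: (uv e).
  exists (eq_rect u (fun w => N (csort w)) m v uv); split=> [vu|e]; first by case: vu.
  by rewrite (Prop_irrelevance e uv).
by exists a'; split=> [|v /(proj1 (ha' v))] //; rewrite ((ha' u).2 erefl).
Qed.

Definition sub_ctx G (Q : set (cvar G)) : ctx (lsort L) :=
  Ctx {v | Q v} (fun v => csort (sval v)).

Definition restr G (Q : set (cvar G)) (a : asg N G) : asg N (sub_ctx Q) :=
  fun v => a (sval v).

(** Contexts may be infinite, but a formula mentions finitely many variables. Recording them is what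
    lets compactness reduce to finitely many values, and infinite tuples of parameters to finite
    ones. *)
Definition definable_on G (Q : set (cvar G)) (X : set (asg N G)) :=
  exists p : formula (sub_ctx Q), forall a, sat p (restr (Q := Q) a) <-> X a.

Definition is_term_on G (Q : set (cvar G)) s (f : asg N G -> N s) :=
  exists t : term (sub_ctx Q) s, forall a, eval (restr (Q := Q) a) t = f a.

Lemma is_term_on_var G (Q : set (cvar G)) (v : cvar G) :
  Q v -> is_term_on Q (fun a => a v).
Proof. by move=> Qv; exists (Var (exist _ v Qv : cvar (sub_ctx Q))). Qed.

Lemma is_term_on_sub G (Q Q' : set (cvar G)) s (f : asg N G -> N s) :
  Q `<=` Q' -> is_term_on Q f -> is_term_on Q' f.
Proof.
move=> sQ [t ht].
have /dep_choice [h hh] : forall v : cvar (sub_ctx Q),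
    exists t : term (sub_ctx Q') (csort v), forall a, eval (restr (Q := Q') a) t = a (sval v).
  by move=> v; apply: is_term_on_var; apply: sQ; case: v.
exists (tsubst h t) => a; rewrite eval_tsubst -ht (_ : (fun v => _) = restr a) //.
by apply: functional_extensionality_dep => v; rewrite hh.
Qed.

Lemma definable_on_subst G D (Q : set (cvar G)) (Q' : set (cvar D))
    (X : set (asg N G)) (r : asg N D -> asg N G) :
  (forall v, Q v -> is_term_on Q' (fun a => r a v)) -> definable_on Q X ->
  definable_on Q' (fun a => X (r a)).
Proof.
move=> hr [p hp].
have /dep_choice [h hh] : forall v : cvar (sub_ctx Q), exists t : term (sub_ctx Q') (csort v),
   forall a, eval (restr (Q := Q') a) t = r a (sval v).
  by case=> v Qv; have [t ht] := hr v Qv; exists t.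
exists (fsubst h p) => a; rewrite sat_fsubst -hp.
rewrite (_ : (fun v => _) = restr (r a)) //.
by apply: functional_extensionality_dep => v; rewrite hh.
Qed.

Lemma definable_on_sub G (Q Q' : set (cvar G)) (X : set (asg N G)) :
  Q `<=` Q' -> definable_on Q X -> definable_on Q' X.
Proof.
by move=> sQ; apply: definable_on_subst => v /sQ; apply: is_term_on_var.
Qed.

Lemma definable_on_setT G (X : set (asg N G)) :
  definable X -> definable_on setT X.
Proof.
move=> [p hp].
have /dep_choice [h hh] : forall v : cvar G,
    exists t : term (sub_ctx (@setT (cvar G))) (csort v),
      forall a, eval (restr (Q := setT) a) t = a v.
  by move=> v; apply: is_term_on_var.
exists (fsubst h p) => a; rewrite sat_fsubst -hp.
by rewrite (_ : (fun v => _) = a) //; apply: functional_extensionality_dep => v; rewrite hh.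
Qed.

Lemma term_support G s (t : term G s) :
  exists2 Q, finite_set Q & is_term_on Q (fun a => eval a t).
Proof.
elim: t => [v|f args IH].
  by exists [set v]; [exact: finite_set1|exact: is_term_on_var].
have /dep_choice [Q hQ] : forall i, exists Q, finite_set Q /\
    is_term_on Q (fun a => eval a (args i)).
  by move=> i; have [Q] := IH i; exists Q.
exists (\bigcup_i Q i).
  by apply: bigcup_finite => [|i _]; [exact: finite_finset|have [] := hQ i].
have /dep_choice [t ht] : forall i, exists t, forall a,
    eval (restr (Q := \bigcup_i Q i) a) t = eval a (args i).
  move=> i; have [_] := hQ i; apply: is_term_on_sub => v Qv; exists i => //.
by exists (App t) => a /=; congr fint; apply: functional_extensionality_dep.
Qed.

Lemma formula_support G (p : formula G) :
  exists2 Q, finite_set Q & definable_on Q (sat (N := N) p).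
Proof.
elim: p => {G} [G|G s t u|G r args|G p [Q fQ [p' hp]]
  |G p [Q fQ dp] q [Q' fQ' dq]|G s p [Q fQ [p' hp]]].
- by exists set0; [exact: finite_set0|exists (Bot _)].
- have [Q fQ tQ] := term_support t; have [Q' fQ' uQ] := term_support u.
  exists (Q `|` Q'); first by rewrite finite_setU.
  have [t' ht] := is_term_on_sub (@subsetUl _ Q Q') tQ.
  have [u' hu] := is_term_on_sub (@subsetUr _ Q Q') uQ.
  by exists (Equal t' u') => a /=; rewrite ht hu.
- have /dep_choice [Q hQ] : forall i, exists Q, finite_set Q /\
      is_term_on Q (fun a => eval a (args i)).
    by move=> i; have [Q] := term_support (args i); exists Q.
  exists (\bigcup_i Q i).
    by apply: bigcup_finite => [|i _]; [exact: finite_finset|have [] := hQ i].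
  have /dep_choice [t ht] : forall i, exists t, forall a,
      eval (restr (Q := \bigcup_i Q i) a) t = eval a (args i).
    by move=> i; have [_] := hQ i; apply: is_term_on_sub => v Qv; exists i.
  exists (Rel t) => a /=.
  by rewrite (_ : (fun i => _) = fun i => eval a (args i)) //; apply: functional_extensionality_dep.
- by exists Q => //; exists (Neg p') => a /=; rewrite hp.
- exists (Q `|` Q'); first by rewrite finite_setU.
  have [p' hp] := definable_on_sub (@subsetUl _ Q Q') dp.
  have [q' hq] := definable_on_sub (@subsetUr _ Q Q') dq.
  by exists (And p' q') => a /=; rewrite hp hq.
- pose Q' : set (cvar G) := [set v | Q (Some v)].
  exists Q'.
    by apply: finite_preimage => // v w _ _ [].
  have /dep_choice [h hh] : forall v : cvar (sub_ctx Q),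
      exists t : term (ext_ctx (sub_ctx Q') s) (csort v), forall a m,
        eval (ext_asg (restr (Q := Q') a) m) t = ext_asg (G := G) a m (sval v).
    case=> -[v|] Qv; last by exists (@Var _ (ext_ctx (sub_ctx Q') s) None).
    by exists (@Var _ (ext_ctx (sub_ctx Q') s) (Some (exist Q' v Qv))).
  exists (Ex (fsubst h p')) => a /=.
  have E m : (fun v => eval (ext_asg (restr (Q := Q') a) m) (h v)) =
      restr (ext_asg a m).
    by apply: functional_extensionality_dep => v; rewrite hh.
  split=> -[m]; first by move=> /sat_fsubst; rewrite E => /hp; exists m.
  by move=> /hp hm; exists m; apply/sat_fsubst; rewrite E.
Qed.

Lemma definable_support G (X : set (asg N G)) : definable X ->
  exists2 Q, finite_set Q & definable_on Q X.
Proof.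
move=> [p hp]; have [Q fQ [p' hp']] := formula_support p; exists Q => //.
by exists p' => a; rewrite hp' hp.
Qed.

Lemma definable_on_agree G (Q : set (cvar G)) (X : set (asg N G)) a b :
  definable_on Q X -> (forall v, Q v -> a v = b v) -> X a -> X b.
Proof.
move=> [p hp] ab; rewrite -hp -[X b]hp (_ : restr a = restr b) //.
by apply: functional_extensionality_dep => -[v Qv]; exact: ab.
Qed.

(** A variable already present in the context is bound in place: the fresh variable [None] takes
    over the role of [u], so [u] leaves the support. *)
Lemma definable_on_ex G (Q : set (cvar G)) (u : cvar G) (X : set (asg N G)) :
  definable_on Q X ->
  definable_on (Q `\ u)
    (fun a => exists a', (forall v, v <> u -> a' v = a v) /\ X a').
Proof.
move=> [p hp]; pose Q' := Q `\ u.
have /dep_choice [h hh] : forall v : cvar (sub_ctx Q),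
    exists t : term (ext_ctx (sub_ctx Q') (csort u)) (csort v), forall a,
      eval (ext_asg (restr (Q := Q') a) (a u)) t = a (sval v).
  case=> v Qv; have [vu|vu] := pselect (v = u).
    by subst v; exists (@Var _ (ext_ctx (sub_ctx Q') (csort u)) None).
  by exists (@Var _ (ext_ctx (sub_ctx Q') (csort u)) (Some (exist Q' v (conj Qv vu)))).
have E a : (fun v => eval (ext_asg (restr (Q := Q') a) (a u)) (h v)) = restr a.
  by apply: functional_extensionality_dep => v; rewrite hh.
exists (Ex (fsubst h p)) => a /=.
have R a' : (forall v, v <> u -> a' v = a v) -> restr (Q := Q') a = restr a'.
  by move=> aa'; apply: functional_extensionality_dep => -[v [Qv vu]]; rewrite /restr aa'.
split=> [[m /sat_fsubst]|[a' [aa' /hp Xa']]].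
  have [a' [<- aa']] := update_exists a m.
  by rewrite (R a' aa') E => /hp; exists a'.
by exists (a' u); apply/sat_fsubst; rewrite (R a' aa') E.
Qed.

Lemma definable_on_ex_in G (l : seq (cvar G)) (X : set (asg N G)) : forall Q,
  definable_on Q X ->
  definable_on (Q `\` [set v | List.In v l])
    (fun a => exists a', (forall v, ~ List.In v l -> a' v = a v) /\ X a').
Proof.
elim: l => [|u l IH] Q dX.
  have sQ : Q `<=` Q `\` [set v | List.In v [::]] by move=> v Qv; split.
  have [p hp] := definable_on_sub sQ dX.
  exists p => a; rewrite hp; split=> [Xa|[a' [aa' Xa']]]; first by exists a.
  by rewrite (_ : a = a') //; apply: functional_extensionality_dep => v; rewrite aa'.
have := definable_on_ex u (IH _ dX).
rewrite (_ : (Q `\` _) `\ u = Q `\` [set v | List.In v (u :: l)]); last first.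
  apply/seteqP; split=> v /=; first by move=> [[Qv vl] vu]; split=> // -[uv|//]; apply: vu.
  by move=> [Qv /not_orP [uv vl]]; split=> [//|vu]; apply: uv.
move=> [p hp]; exists p => a; rewrite hp; split.
  move=> [a1 [aa1 [a' [a1a' Xa']]]]; exists a'; split=> // v /not_orP [uv vl].
  by rewrite a1a' // aa1 // => vu; apply: uv.
move=> [a' [aa' Xa']].
have [a1 [a1u a1a]] := update_exists a (a' u).
exists a1; split=> //; exists a'; split=> // v vl.
have [->|vu] := pselect (v = u); first by rewrite a1u.
by rewrite a1a // aa' // => -[uv|//]; apply: vu.
Qed.

(** The variables of [D] are projected away one at a time. The result no longer depends on them, so
    any tuple [b0] may fill their places; since sorts may be empty, the case without such a tuple is
    separate. *)
Lemma definable_ex G D (X : set (asg N (cat_ctx G D))) :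
  finite_set [set: cvar D] -> definable X ->
  definable (fun a => exists b, X (cat_asg a b)).
Proof.
move=> /finite_list [l hl] dX.
have [[b0 _]|nb] := pselect (exists b : asg N D, True); last first.
  apply: definable_ext (definable_false N G) => a; split=> // -[b _].
  by case: nb; exists b.
have inl_l v : List.In v l by rewrite -[List.In v l]/([set x | List.In x l] v) -hl.
pose l' : seq (cvar (cat_ctx G D)) := [seq inr v | v <- l].
have [p hp] := definable_on_ex_in l' (definable_on_setT dX).
pose Q := [set: cvar (cat_ctx G D)] `\` [set v | List.In v l'].
have hr v : is_term (fun a : asg N G => restr (Q := Q) (cat_asg a b0) v).
  case: v => -[v|v] [vT vl]; first exact: is_term_var.
  by case: vl; apply: List.in_map.
have [q hq] := definable_subst hr (definable_sat N p).
exists q => a; rewrite hq hp; split.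
  move=> [c [ca Xc]]; exists (fun v => c (inr v)).
  rewrite (_ : cat_asg _ _ = c) //; apply: functional_extensionality_dep => -[v|v] //=.
  by rewrite ca // => /List.in_map_iff [w []].
move=> [b Xb]; exists (cat_asg a b); split=> // -[v|v] //= nl.
by case: nl; apply: List.in_map.
Qed.

End Support.

(** * Counting solutions *)

Definition at_least (X : Type) (k : nat) (A : set X) :=
  exists u : 'I_k -> X, injective u /\ forall i, A (u i).

Lemma at_least_sub (X : Type) k (A B : set X) :
  A `<=` B -> at_least k A -> at_least k B.
Proof. by move=> AB [u [iu Au]]; exists u; split=> // i; apply: AB. Qed.

Lemma at_leastS (X : Type) k (A : set X) :
  at_least k.+1 A <-> exists2 x, A x & at_least k (A `\ x).
Proof.
split=> [[u [iu Au]]|[x Ax [u [iu Au]]]].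
  exists (u ord0) => //; exists (fun i => u (lift ord0 i)); split.
    by move=> i j /iu /lift_inj.
  by move=> i; split=> // /iu /(congr1 val).
exists (fun i => if unlift ord0 i is Some j then u j else x); split.
  move=> i j; case: (unliftP ord0 i) => [i' ->|->];
    case: (unliftP ord0 j) => [j' ->|->] //.
  - by move=> /iu ->.
  - by case: (Au i').
  - by move=> /esym; case: (Au j').
by move=> i; case: (unlift ord0 i) => [j|] //; case: (Au j).
Qed.

Lemma at_leastW (X : Type) k (A : set X) : at_least k.+1 A -> at_least k A.
Proof. by move=> /at_leastS [x Ax]; apply: at_least_sub => y []. Qed.

Section Definable.
Variables (L : language) (N : structure L).
Implicit Types G D : ctx (lsort L).

Lemma definable_asg_eq G D (f g : asg N G -> asg N D) :
  finite_set [set: cvar D] -> is_subst f -> is_subst g ->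
  definable (fun a => f a = g a).
Proof.
move=> /finite_list [l hl] tf tg.
have dv v : List.In v l -> definable (fun a => f a v = g a v).
  by move=> _; apply: definable_eq.
apply: definable_ext (definable_all_in dv) => a; split=> [fg|-> //].
apply: functional_extensionality_dep => v; apply: fg.
by rewrite -[List.In v l]/([set x | List.In x l] v) -hl.
Qed.

(** In the induction the first witness becomes a further parameter, from which the remaining
    witnesses must differ; hence the quantification over all [G]. *)
Lemma definable_at_least (y : ctx (lsort L)) k :
  finite_set [set: cvar y] -> forall G (X : set (asg N (cat_ctx y G))),
  definable X -> definable (fun c => at_least k (fun a => X (cat_asg a c))).
Proof.
move=> fy; elim: k => [|k IH] G X dX.
  apply: definable_ext (definable_true N G) => c; split=> // _.
  by exists (fun i : 'I_0 => False_rect _ (notF (ltn_ord i))); split; case.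
pose Y (c : asg N (cat_ctx y (cat_ctx G y))) :=
  X (cat_asg (lasg c) (lasg (rasg c))) /\ ~ (lasg c = rasg (rasg c)).
have dY : definable Y.
  apply: definable_and.
    by apply: definable_subst dX; auto.
  by apply/definable_not/definable_asg_eq; auto.
have dX' : definable (fun c : asg N (cat_ctx G y) => X (cat_asg (rasg c) (lasg c))).
  by apply: definable_subst dX; auto.
apply: definable_ext (definable_ex fy (definable_and dX' (IH _ _ dY))) => c.
by rewrite at_leastS; split=> [[a [Xa h]]|[a Xa h]]; exists a.
Qed.

End Definable.

(** * Compactness *)

Lemma filter_In (X : Type) (Q : set X) (l : seq X) (x : X) :
  List.In x [seq y <- l | `[< Q y >]] <-> List.In x l /\ Q x.
Proof.
elim: l => [|y l IH] /=; first by split=> [|[]].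
case: asboolP => Qy /=; rewrite IH; split.
- by move=> [<-|[xl Qx]]; split=> //; [left|right].
- by move=> [[->|xl] Qx]; [left|right].
- by move=> [xl Qx]; split=> //; right.
- by move=> [[yx|xl] Qx]; [case: Qy; rewrite yx|].
Qed.

Lemma set_inj_card_le (X Y : Type) (A : set X) (f : X -> Y) :
  {in A &, injective f} -> A #<= [set: Y].
Proof.
move=> fI; apply: (@card_le_trans _ _ _ (f @` A)); last exact: card_leT.
by have := inj_card_eq fI; rewrite card_eq_sym card_eq_le => /andP[].
Qed.

Section Compactness.
Variables (L : language) (N : structure L).
Implicit Types G D : ctx (lsort L).

Lemma lsat_inst G D (d : formula (cat_ctx G D)) (a : asg N D) (b : asg N G) :
  lsat (inst d a) b <-> sat d (cat_asg b a).
Proof.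
rewrite /lsat /inst sat_fsubst (_ : (fun v => _) = cat_asg b a) //.
by apply: functional_extensionality_dep => -[].
Qed.

(** A partial assignment of the variables of [G] is given by its graph. *)
Local Notation pt := (existT (fun v => car N (csort v))).

Definition agrees G (R : set {v : cvar G & N (csort v)}) (e : asg N G) :=
  forall r, R r -> e (projT1 r) = projT2 r.

Definition sat_with G (R : set {v : cvar G & N (csort v)})
    (s : seq (set (asg N G))) (e : asg N G) :=
  agrees R e /\ forall X, List.In X s -> X e.

Definition fin_satisfiable_with G (Gam : set (set (asg N G)))
    (R : set {v : cvar G & N (csort v)}) :=
  forall s, (forall X, List.In X s -> Gam X) -> exists e, sat_with R s e.

(** The sets in [Gam] are definable without parameters; parameters enter through [R], which
    prescribes the values of some of the variables. *)
Definition compact_in G :=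
  forall (Gam : set (set (asg N G))) (R : set {v : cvar G & N (csort v)}),
    (forall X, Gam X -> definable X) -> fin_satisfiable_with Gam R ->
    exists e, agrees R e /\ forall X, Gam X -> X e.

Lemma agrees_functional G R (v : cvar G) (m m' : N (csort v)) e :
  agrees R e -> R (pt v m) -> R (pt v m') -> m = m'.
Proof. by move=> Re /Re /= <- /Re /= <-. Qed.

(** The support of [X] is finite. Its unassigned variables other than [v] ([l1]) are quantified, and
    the values of its assigned ones ([l2]) become the parameters. *)
Lemma param_definable G (R : set {v : cvar G & N (csort v)}) (v : cvar G)
    (X : set (asg N G)) (e0 : asg N G) :
  agrees R e0 -> ~ (exists m, R (pt v m)) -> definable X ->
  exists f : lformula N (FCtx 1 (fun _ => csort v)),
    is_over [set elem_of (projT2 r) | r in R] f /\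
    forall m, lsat f m <-> exists e, [/\ agrees R e, X e & e v = m ord0].
Proof.
move=> Re0 Rv dX; have [Q /finite_list [l lQ] dQ] := definable_support dX.
pose dom : set (cvar G) := [set u | exists m, R (pt u m)].
pose l1 := [seq u <- l | `[< ~ dom u /\ u <> v >]].
pose l2 := [seq u <- l | `[< dom u >]].
pose y := FCtx (size l2) (fun i => csort (tnth (in_tuple l2) i)).
pose a : asg N y := fun i => e0 (tnth (in_tuple l2) i).
pose x := FCtx 1 (fun _ => csort v).
have dom_l2 i : dom (tnth (in_tuple l2) i).
  by have := tnth_In i; rewrite /l2 filter_In => -[].
have [p hp] := definable_on_ex_in l1 dQ.
have tm u : Q u -> ~ List.In u l1 ->
    exists t : term (cat_ctx x y) (csort u), forall (m : asg N x) (e : asg N G),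
      e v = m ord0 -> (forall w, w <> v -> e w = e0 w) ->
      eval (cat_asg m a) t = e u.
  move=> Qu ul1; have [uv|uv] := pselect (u = v).
    by subst u; exists (@Var _ (cat_ctx x y) (inl ord0)) => m e /= ->.
  have Du : dom u.
    by apply: contrapT => Du; apply: ul1; rewrite /= filter_In; split=> //; rewrite lQ in Qu.
  have ul2 : List.In u l2 by apply/filter_In; split=> //; rewrite lQ in Qu.
  have [i ui] := In_tnth ul2.
  by subst u; exists (@Var _ (cat_ctx x y) (inr i)) => m e _ /= e0e; rewrite e0e.
have /dep_choice [h hh] :=
  fun u : cvar (sub_ctx (Q `\` [set u | List.In u l1])) =>
    tm _ (svalP u).1 (svalP u).2.
exists (inst (fsubst h p) a); split.
  exists y, (fsubst h p), a; split=> // _ [i _ <-].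
  have [m Rm] := dom_l2 i; exists (pt _ m) => //=.
  by rewrite /a (Re0 _ Rm).
move=> m; rewrite lsat_inst sat_fsubst.
have [e1 [e1v e1e0]] := update_exists e0 (m ord0).
have -> : (fun u => eval (cat_asg m a) (h u)) = restr e1.
  by apply: functional_extensionality_dep => u; rewrite (hh u m e1).
rewrite hp; split=> [[e [ee1 Xe]]|[e [Re Xe ev]]].
  have /dep_choice [e' he'] (u : cvar G) : exists n : N (csort u),
      (dom u \/ u = v -> n = e1 u) /\ (~ (dom u \/ u = v) -> n = e u).
    by have [du|du] := pselect (dom u \/ u = v); [exists (e1 u)|exists (e u)].
  exists e'; split.
  - move=> [u n] Rn /=; have du : dom u by exists n.
    rewrite (he' u).1; last by left.
    rewrite e1e0 ?(Re0 _ Rn) // => uv; apply: Rv; exact: (eq_ind u dom du v uv).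
  - apply: definable_on_agree dQ _ Xe => u Qu.
    have [du|du] := pselect (dom u \/ u = v); last by rewrite (he' u).2.
    rewrite (he' u).1 // ee1 // filter_In => -[_ [d1 d2]].
    by case: du.
  - by rewrite (he' v).1 //; right.
have /dep_choice [e' he'] (u : cvar G) : exists n : N (csort u),
    (List.In u l1 -> n = e u) /\ (~ List.In u l1 -> n = e1 u).
  by have [du|du] := pselect (List.In u l1); [exists (e u)|exists (e1 u)].
exists e'; split; first by move=> u /(he' u).2.
apply: definable_on_agree dQ _ Xe => u Qu.
have [ul|ul] := pselect (List.In u l1); first by rewrite (he' u).1.
rewrite (he' u).2 //; have [uv|uv] := pselect (u = v).
  by subst u; rewrite e1v.
have [n Rn] : dom u.
  apply: contrapT => Du; apply: ul; rewrite filter_In; split=> //.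
  by rewrite lQ in Qu.
by rewrite e1e0 // (Re0 _ Rn) (Re _ Rn).
Qed.

Lemma chain_cover (T : Type) (R0 : set T) (F : set (set T)) (l : seq T) :
  total_on F subset ->
  (forall r, List.In r l -> (R0 `|` \bigcup_(S in F) S) r) ->
  exists S, (F S \/ S = set0) /\ forall r, List.In r l -> (R0 `|` S) r.
Proof.
move=> totF; elim: l => [_|r l IH lF]; first by exists set0; split=> //; right.
have [|S [FS lS]] := IH; first by move=> r' lr'; apply: lF; right.
case: (lF r (or_introl erefl)) => [Rr|[S' FS' S'r]].
  by exists S; split=> // r' [<-|/lS //]; left.
have [SS'|S'S] : S `<=` S' \/ S' `<=` S.
- by case: FS => [FS|->]; [exact: totF|left].
- exists S'; split; first by left.
  by move=> r' [<-|/lS]; [right|move=> [R0r|Sr]; [left|right; apply: SS']].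
- by exists S; split=> // r' [<-|/lS //]; right; apply: S'S.
Qed.

(** A finite part of [Gam] depends on finitely many variables, and the values prescribed for these
    lie in one member of the chain. Overwriting a solution for that member by all the prescribed
    values does not change it on the support. *)
Lemma fin_satisfiable_chain G (Gam : set (set (asg N G)))
    (R0 : set {v : cvar G & N (csort v)}) (F : set (set {v : cvar G & N (csort v)})) :
  (forall X, Gam X -> definable X) -> fin_satisfiable_with Gam R0 ->
  total_on F subset ->
  (forall S, F S -> fin_satisfiable_with Gam (R0 `|` S)) ->
  fin_satisfiable_with Gam (R0 `|` \bigcup_(S in F) S).
Proof.
move=> dGam sR0 totF sF s sGam; set R := _ `|` _.
have sF0 S : F S \/ S = set0 -> fin_satisfiable_with Gam (R0 `|` S).
  by case=> [/sF //|->]; rewrite setU0.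
have [Q /finite_list [l lQ] dQ] :=
  definable_support (definable_all_in (fun X hX => dGam X (sGam X hX))).
pose dom : set (cvar G) := [set u | exists m, R (pt u m)].
have /dep_choice [e1 he1] (v : cvar G) : exists o : option (N (csort v)),
    if o is Some m then R (pt v m) else ~ dom v.
  by have [[m Rm]|nm] := pselect (dom v); [exists (Some m)|exists None].
pose l' := flatten [seq (if e1 v is Some m then [:: pt v m] else [::]) | v <- l].
have l'P r : List.In r l' <-> List.In (projT1 r) l /\ e1 (projT1 r) = Some (projT2 r).
  rewrite /l'; elim: l {lQ l'} => [|v l IH] /=; first by split=> // -[].
  rewrite List.in_app_iff IH; split=> [[|[lr er]]|[[vr|lr] er]].
  - by case E: (e1 v) => [m|] //= -[<-|//]; split=> //; left.
  - by split=> //; right.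
  - by left; case: r vr er {IH} => u m /= vr; subst u => ->; left.
  - by right.
have [r /l'P [_]|S [FS lS]] := @chain_cover _ R0 F l' totF.
  by move=> er; have := he1 (projT1 r); rewrite er; case: r {er}.
have [e [Re se]] := sF0 S FS s sGam.
have func v m m' : R (pt v m) -> R (pt v m') -> m = m'.
  move=> Rm Rm'.
  have [r [<- //|[<- //|//]]|S' [FS' lS']] := @chain_cover _ R0 F [:: pt v m; pt v m'] totF.
  have [e' [Re' _]] := sF0 S' FS' [::] (fun X (h : False) => False_ind _ h).
  by apply: (agrees_functional Re'); apply: lS'; [left|right; left].
exists (fun v => odflt (e v) (e1 v)); split.
  move=> [v m] Rm /=; have := he1 v; case: (e1 v) => [m' /= Rm'|]; first exact: func Rm' Rm.
  by case; exists m.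
apply: definable_on_agree dQ _ se => v; rewrite lQ /= => lv.
case E: (e1 v) => [m|] //=; apply: (Re (pt v m)); apply: lS; exact/l'P.
Qed.

(** A partial assignment maximal among those with which [Gam] is finitely
    satisfiable is total: a missing value is provided by saturation. *)
Lemma saturated_compact (kappa : Type) G :
  saturated kappa N -> small kappa [set: cvar G] -> compact_in G.
Proof.
move=> satN smallG Gam R0 dGam sR0.
pose P S := fin_satisfiable_with Gam (R0 `|` S).
have [|S [PS maxS]] := @Zorn_bigcup _ P.
  by move=> F FP totF; apply: fin_satisfiable_chain.
set R := R0 `|` S in PS.
have [e0 [Re0 _]] := PS [::] (fun X (h : False) => False_ind _ h).
pose A := [set elem_of (projT2 r) | r in R].
have smallA : small kappa A.
  (* [R] is functional because [e0] extends it, so there are at most as many parameters as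
     variables. *)
  have AG : A #<= [set: cvar G].
    apply: (@card_le_trans _ _ _ R); first exact: card_image_le.
    apply: (@set_inj_card_le _ _ _ (@projT1 _ _)).
    move=> [v m] [w n] /set_mem Rm /set_mem Rn /= vw; subst w.
    by rewrite (agrees_functional Re0 Rm Rn).
  split; first exact: card_le_trans AG smallG.1.
  by move=> kA; apply: smallG.2; apply: card_le_trans kA AG.
have domR v : exists m, R (pt v m).
  apply: contrapT => nv; pose x := FCtx 1 (fun _ => csort v).
  (* [p] collects what a value of [v] must satisfy for every finite part of [Gam] to keep a solution
     extending [R]. Adding a realization of [p] to [S] contradicts maximality. *)
  pose p : set (lformula N x) := [set f | is_over A f /\ exists s,
    (forall X, List.In X s -> Gam X) /\
    forall m : asg N x, lsat f m <-> exists e, sat_with R s e /\ e v = m ord0].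
  have [|b pb] := satN A x p smallA.
    split; first by move=> f [].
    move=> F Fp /finite_list [l lF]; have {}Fp f : List.In f l -> p f.
      by move=> fl; apply: Fp; rewrite lF.
    have [s [sGam hs]] : exists s, (forall X, List.In X s -> Gam X) /\
        forall f, List.In f l -> forall (m : asg N x) (e : asg N G),
          sat_with R s e -> e v = m ord0 -> lsat f m.
      elim: l Fp {lF} => [|f l IH] Fp; first by exists [::].
      have [|s [sG hs]] := IH; first by move=> g gl; apply: Fp; right.
      have [_ [s' [sG' hs']]] := Fp f (or_introl erefl).
      exists (s ++ s'); split.
        by move=> X /List.in_app_iff [/sG|/sG'].
      move=> g [<-|gl] m e [Re se] ev.
        apply/hs'; exists e; split=> //; split=> // X Xs; apply: se.
        by apply/List.in_app_iff; right.
      by apply: (hs g gl m e) => //; split=> // X Xs; apply: se; apply/List.in_app_iff; left.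
    have [e se] := PS s sGam; exists (fun _ => e v) => f; rewrite lF => fl.
    exact: hs fl _ e se erefl.
  have [] := maxS (S `|` [set pt v (b ord0)]).
    split; first exact: subsetUl.
    by move=> /(_ (pt v (b ord0)) (or_intror erefl)) Sv; apply: nv; exists (b ord0); right.
  move=> s sGam; have [e1 [_ se1]] := PS s sGam.
  have dX : definable (fun a => forall X, List.In X s -> X a).
    by apply: definable_all_in => X /sGam; apply: dGam.
  have [f [fA hf]] := param_definable Re0 nv dX.
  have /hf [e [Re se ev]] : lsat f b.
    apply: pb; split=> //; exists s; split=> // m; rewrite hf.
    by split=> [[e [Re se ev]]|[e [[Re se] ev]]]; exists e.
  exists e; split=> // r; rewrite setUA => -[/Re //|->] //=.
have /dep_choice [e he] := domR; exists e.
have Re : agrees R e.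
  by move=> [v m] Rm /=; apply: agrees_functional Re0 (he v) Rm.
split; first by move=> r R0r; apply: Re; left.
move=> X GX; have [|e1 [Re1 se1]] := PS [:: X]; first by move=> Y [<-|].
rewrite (_ : e = e1); first by apply: se1; left.
by apply: functional_extensionality_dep => v; rewrite (Re1 _ (he v)).
Qed.

End Compactness.

(** * Imaginaries *)

Lemma fctx_finite (S : Type) (x : fctx S) : finite_set [set: cvar x].
Proof. exact: (@finite_finset 'I_(fsize x)). Qed.

Section HomeSort.
Variables (L : language) (M : structure L).
Implicit Types G D : ctx (lsort (Leq M)).

Definition home_sort (s : lsort (Leq M)) : fctx (lsort L) :=
  match s with inl s => FCtx 1 (fun _ => s) | inr E => eq_ctx E end.

Definition proj_sort (s : lsort (Leq M)) : asg M (home_sort s) -> Meq M s :=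
  match s with
  | inl s => fun a => a ord0
  | inr E => fun a => class_of (E := E) a
  end.
Arguments proj_sort : clear implicits.

Lemma sval_inj (X : Type) (P : X -> Prop) : injective (@sval X P).
Proof. by move=> [x p] [y q] /= xy; subst y; congr exist. Qed.

Lemma class_of_eq (E : def_equiv M) (a b : asg M (eq_ctx E)) :
  class_of a = class_of b <-> eq_rel (d := E) a b.
Proof.
split=> [/(congr1 (@sval _ _)) /= /(congr1 (fun S : set _ => S b)) /= ->|ab].
  exact: Defs.eq_refl.
apply: sval_inj; apply/seteqP; split=> c /=; apply: Defs.eq_trans => //.
exact: Defs.eq_sym.
Qed.

Lemma proj_sort_surj s (m : Meq M s) : exists a, proj_sort s a = m.
Proof.
case: s m => [s m|E [C [a CE]]]; first by exists (fun _ => m).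
by exists a; apply: sval_inj.
Qed.

(** Each variable becomes a tuple of home variables representing its value: an element represents
    itself, a class is represented by any of its members. *)
Definition home G : ctx (lsort L) :=
  Ctx {v : cvar G & 'I_(fsize (home_sort (csort v)))} (fun w => fsort (projT2 w)).

Definition home_at G (a : asg M (home G)) (v : cvar G) :
    asg M (home_sort (csort v)) :=
  fun i => a (existT _ v i).
Arguments home_at {G} a v.

Definition proj_asg G (a : asg M (home G)) : asg (Meq M) G :=
  fun v => proj_sort _ (home_at a v).

Lemma term_home G s (t : term G s) :
  exists h : forall i : cvar (home_sort s), term (home G) (csort i),
    forall a, eval (proj_asg a) t = proj_sort s (fun i => eval a (h i)).
Proof.
elim: t => [v|f args IH].
  by exists (fun i => @Var _ (home G) (existT _ v i)).
have {IH} /dep_choice [h hh] := IH.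
case: f args h hh => [g|E] args h hh.
  exists (fun _ => App (f := g) (fun i => h i ord0)) => a /=.
  by congr fint; apply: functional_extensionality_dep => i; rewrite hh.
exists (fun i => h i ord0) => a /=.
by congr class_of; apply: functional_extensionality_dep => i; rewrite hh.
Qed.

(** Equality of classes turns into the formula defining the equivalence relation, and a quantifier
    over classes into one over representatives. *)
Lemma formula_home G (p : formula G) :
  definable (fun a : asg M (home G) => sat (N := Meq M) p (proj_asg a)).
Proof.
elim: p => {G} [G|G s t u|G r args|G p IH|G p IHp q IHq|G s p IH] /=.
- exact: definable_false.
- have [h hh] := term_home t; have [h' hh'] := term_home u.
  case: s t u h hh h' hh' => [s|E] t u h hh h' hh'.
    by exists (Equal (h ord0) (h' ord0)) => a; rewrite hh hh'.
  pose r (a : asg M (home G)) : asg M (cat_ctx (eq_ctx E) (eq_ctx E)) :=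
    cat_asg (fun i => eval a (h i)) (fun i => eval a (h' i)).
  have hr : is_subst r by move=> [i|i]; [exists (h i)|exists (h' i)].
  apply: definable_ext (definable_subst hr (definable_sat M (eq_fml E))) => a.
  by rewrite hh hh'; split=> /class_of_eq.
- have /dep_choice [h hh] := fun i => term_home (args i).
  exists (@Rel L (home G) r (fun i => h i ord0)) => a /=.
  rewrite (_ : (fun i => eval a (h i ord0)) = fun i => eval (proj_asg a) (args i)) //.
  by apply: functional_extensionality_dep => i; rewrite hh.
- exact: definable_not.
- exact: definable_and.
- pose r (c : asg M (cat_ctx (home G) (home_sort s))) : asg M (home (ext_ctx G s)) :=
    fun w => match w with
             | existT (Some v) i => c (inl (existT _ v i))
             | existT None i => c (inr i)
             end.
  have hr : is_subst r.
    by move=> [[v|] i]; [exists (@Var _ (cat_ctx (home G) (home_sort s)) (inl (existT _ v i)))|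
      exists (@Var _ (cat_ctx (home G) (home_sort s)) (inr i))].
  apply: definable_ext (definable_ex (fctx_finite _) (definable_subst hr IH)) => a.
  have E b : proj_asg (r (cat_asg a b)) = ext_asg (proj_asg a) (proj_sort s b).
    by apply: functional_extensionality_dep => -[v|].
  split=> [[b]|[m]]; first by rewrite E; exists (proj_sort s b).
  by have [b <-] := proj_sort_surj m; exists b; rewrite E.
Qed.

Lemma definable_home G (X : set (asg (Meq M) G)) :
  definable X -> definable (fun a => X (proj_asg a)).
Proof.
by move=> [p hp]; apply: definable_ext (formula_home p) => a; rewrite hp.
Qed.

(** Saturation is assumed of [M] itself, so the problem is pulled back along [proj_asg], every
    prescribed imaginary value being replaced by a chosen representative. *)
Lemma compact_Meq G : compact_in M (home G) -> compact_in (Meq M) G.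
Proof.
move=> cM Gam R dGam sR.
have [rep hrep] : exists rep : forall s, Meq M s -> asg M (home_sort s),
    forall s m, proj_sort s (rep s m) = m.
  have /dep_choice [rep hrep] := fun s => dep_choice (@proj_sort_surj s).
  by exists rep.
pose GamM := [set Y | exists2 X, Gam X & Y = fun a => X (proj_asg a)].
pose RM : set {w : cvar (home G) & M (csort w)} :=
  [set q | exists2 r, R r & exists i,
     q = existT (fun w => M (csort (c := home G) w)) (existT _ (projT1 r) i)
           (rep _ (projT2 r) i)].
have [||e [Re Ge]] := cM GamM RM.
- by move=> _ [X GX ->]; apply/definable_home/dGam.
- move=> s sGam.
  have [s' [sG' ss']] : exists s', (forall X, List.In X s' -> Gam X) /\
      forall a, (forall X, List.In X s' -> X (proj_asg a)) ->
      forall Y, List.In Y s -> Y a.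
    elim: s sGam => [|Y s IH] sGam; first by exists [::].
    have [|s' [sG' ss']] := IH; first by move=> X Xs; apply: sGam; right.
    have [X GX YX] := sGam Y (or_introl erefl).
    exists (X :: s'); split; first by move=> Z [<-|/sG'].
    move=> a ha Z [<-|]; first by rewrite YX; apply: ha; left.
    by apply: ss' => W Ws; apply: ha; right.
  have [e [Re se]] := sR s' sG'.
  exists (fun w => rep _ (e (projT1 w)) (projT2 w)).
  have E : proj_asg (G := G) (fun w => rep _ (e (projT1 w)) (projT2 w)) = e.
    by apply: functional_extensionality_dep => v; exact: (hrep (csort v) (e v)).
  split; last by apply: ss'; rewrite E.
  by move=> _ [r Rr [i ->]] /=; rewrite (Re r Rr).
exists (proj_asg e); split; last first.
  by move=> X GX; apply: (Ge (fun a => X (proj_asg a))); exists X.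
move=> r Rr; rewrite -[RHS]hrep; congr proj_sort.
apply: functional_extensionality_dep => i.
apply: (Re (existT (fun w => M (csort (c := home G) w)) (existT _ (projT1 r) i) _)).
by exists r => //; exists i.
Qed.

End HomeSort.

(** * Counting formulas *)

Definition embeds (X Y : Type) := exists f : X -> Y, injective f.

Lemma embeds_trans (X Y Z : Type) : embeds X Y -> embeds Y Z -> embeds X Z.
Proof. by move=> [f fi] [g gi]; exists (g \o f); apply: inj_comp. Qed.

Section Count.
Variable L : language.
Implicit Types G D : ctx (lsort L).

Lemma tsubst_comp G D D' (h : forall v : cvar G, term D (csort v))
    (g : forall v : cvar D, term D' (csort v)) s (t : term G s) :
  tsubst g (tsubst h t) = tsubst (fun v => tsubst g (h v)) t.
Proof.
elim: t => //= f args IH.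
by congr App; apply: functional_extensionality_dep.
Qed.

Lemma tsubst_id G s (t : term G s) : tsubst (fun v => Var v) t = t.
Proof.
elim: t => //= f args IH.
by congr App; apply: functional_extensionality_dep.
Qed.

Lemma tsubst_retract G D (h : forall v : cvar G, term D (csort v))
    (g : forall v : cvar D, term G (csort v)) s (t : term G s) :
  (forall v, tsubst g (h v) = Var v) -> tsubst g (tsubst h t) = t.
Proof.
move=> gh; rewrite tsubst_comp -[RHS]tsubst_id (_ : (fun v => _) = @Var L G) //.
exact: functional_extensionality_dep.
Qed.

Lemma fsubst_retract G (p : formula G) : forall D
    (h : forall v : cvar G, term D (csort v))
    (g : forall v : cvar D, term G (csort v)),
  (forall v, tsubst g (h v) = Var v) -> fsubst g (fsubst h p) = p.
Proof.
elim: p => {G} [G|G s t u|G r args|G p IH|G p IHp q IHq|G s p IH] D h g gh //=.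
- by rewrite !tsubst_retract.
- by congr Rel; apply: functional_extensionality_dep => i; rewrite tsubst_retract.
- by rewrite IH.
- by rewrite IHp // IHq.
rewrite IH // => -[v|] //=.
rewrite tsubst_comp /=.
have := congr1 (@tsubst _ _ (ext_ctx G s)
  (fun w : cvar G => @Var _ (ext_ctx G s) (Some w)) _) (gh v).
by rewrite tsubst_comp.
Qed.

Local Notation sentence := (formula (fctx0 (lsort L))).

(** Each free variable is bound by an [Ex] that serves as a mere syntactic wrapper. Nothing is lost,
    because the renaming [h] has the left inverse [g]. *)
Lemma formula_embeds_sentence n (f : 'I_n -> lsort L) :
  embeds (formula (FCtx n f)) sentence.
Proof.
elim: n f => [|n IH] f.
  have -> : FCtx 0 f = fctx0 (lsort L); last by exists id.
  by congr FCtx; apply: funext => -[].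
have [e ei] := IH (fun i => f (lift ord0 i)).
set x := FCtx n.+1 f; set y := FCtx n (fun i => f (lift ord0 i)) in e ei *.
pose s := f ord0.
pose g (v : cvar (ext_ctx y s)) : term x (csort v) :=
  match v with
  | Some j => @Var _ x (lift ord0 j)
  | None => @Var _ x ord0
  end.
have /dep_choice [h hh] : forall v : cvar x, exists t : term (ext_ctx y s) (csort v),
    tsubst g t = Var v.
  move=> v; case: (unliftP ord0 v) => [j|] ->.
    by exists (@Var _ (ext_ctx y s) (Some j)).
  by exists (@Var _ (ext_ctx y s) None).
exists (fun p => e (Ex (fsubst h p))) => p q /ei [] H.
have := congr1 (fsubst g) (inj_pair2 _ _ _ _ _ H).
by rewrite !fsubst_retract.
Qed.

Lemma sentence_seq : embeds (seq sentence) sentence.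
Proof.
exists (foldr (fun p q => And p q) (Bot _)).
by elim=> [|p s IH] [|q t] //= [-> /IH ->].
Qed.

Lemma sort_embeds_sentence : embeds (lsort L) sentence.
Proof.
pose x := @Var _ (ext_ctx (fctx0 (lsort L)) _) None.
exists (fun s => Ex (Equal (x s) (x s))).
by move=> s s' [].
Qed.

Lemma all_formulas_embeds_sentence : embeds (all_formulas L) sentence.
Proof.
have [cs csi] := sort_embeds_sentence; have [cl cli] := sentence_seq.
have /dep_choice [e ei] : forall x : fctx (lsort L),
    exists e : formula x -> sentence, injective e.
  by case=> n f; apply: formula_embeds_sentence.
pose sorts (x : fctx (lsort L)) := [seq fsort i | i <- enum 'I_(fsize x)].
have sorts_inj : injective sorts.
  move=> [n f] [m g]; rewrite /sorts /= => E.
  have nm : n = m.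
    by have := congr1 size E; rewrite !size_map -!enumT !size_enum_ord.
  subst m; congr FCtx; apply: funext => i.
  by move: E => /eq_in_map/(_ i); rewrite mem_enum; apply.
exists (fun p => And (cl (map cs (sorts (projT1 p)))) (e _ (projT2 p))).
move=> [x p] [y q] /= [/cli /(inj_map csi) /sorts_inj xy]; subst y.
by move=> /ei ->.
Qed.

(** Well-founded trees branching over the sentences.  As indices they have the
    property that any family of at most |T| of them has a strict upper bound,
    its [Sup], although there are only 2^|T| of them. *)
Inductive itree := Leaf | Sup of sentence -> itree.

(** The relation of a child to its parent, without transitive closure: the bound of a family is the
    node whose branches it forms. *)
Definition below (i j : itree) : Prop :=
  match j with Leaf => False | Sup f => exists z, f z = i end.

Lemma below_wf : well_founded below.
Proof.
move=> i; elim: i => [|f IH]; constructor; first by [].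
by move=> _ [z <-].
Qed.

(** The addresses of the inner nodes. They determine the tree, and each is a finite sequence of
    sentences, whence at most 2^|T| trees. *)
Fixpoint branches (i : itree) : set (seq sentence) :=
  match i with
  | Leaf => set0
  | Sup f => fun s => match s with [::] => True | z :: s => branches (f z) s end
  end.

Lemma branches_inj : injective branches.
Proof.
elim=> [|f IH] [|g] //= E.
- by have : set0 ([::] : seq sentence) by rewrite E.
- by have : set0 ([::] : seq sentence) by rewrite -E.
congr Sup; apply: funext => z; apply: IH; apply: funext => s.
exact: (congr1 (fun S : set _ => S (z :: s)) E).
Qed.

(** Cardinality at most 2^|T|, which a monster model keeps below [kappa]. For products and sums the
    constructors of formulas serve as tags. *)
Definition tiny (X : Type) := embeds X (set sentence).

Lemma set_embeds (X Y : Type) : embeds X Y -> embeds (set X) (set Y).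
Proof.
move=> [f fi]; exists (fun A => f @` A) => A B AB; apply/seteqP; split=> x Ax.
  by have : (f @` B) (f x); [rewrite -AB; exists x|case=> y By /fi <-].
by have : (f @` A) (f x); [rewrite AB; exists x|case=> y By /fi <-].
Qed.

Lemma tiny_embeds (X Y : Type) : embeds X Y -> tiny Y -> tiny X.
Proof. exact: embeds_trans. Qed.

Lemma tiny_itree : tiny itree.
Proof.
apply: (@embeds_trans _ (set (seq sentence))); first by exists branches; exact: branches_inj.
exact/set_embeds/sentence_seq.
Qed.

Lemma tiny_prod (X Y : Type) : tiny X -> tiny Y -> tiny (X * Y).
Proof.
move=> [f fi] [g gi].
exists (fun xy => [set p | match p with
  | Neg q => f xy.1 q | And q _ => g xy.2 q | _ => False end]).
move=> [x y] [x' y'] E; congr pair.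
  apply: fi; apply: funext => q; exact: (congr1 (fun S : set _ => S (Neg q)) E).
apply: gi; apply: funext => q; exact: (congr1 (fun S : set _ => S (And q q)) E).
Qed.

Lemma nat_embeds : embeds nat sentence.
Proof.
exists (fun n => iter n (fun p => Neg p) (Bot _)).
by elim=> [|n IH] [|m] //= [/IH ->].
Qed.

Lemma tiny_sentence (X : Type) : embeds X sentence -> tiny X.
Proof.
move=> [f fi]; exists (fun x => [set f x]) => x y /(congr1 (fun S : set _ => S (f x))) /= E.
by apply: fi; rewrite -E.
Qed.

Lemma tiny_nat : tiny nat. Proof. exact/tiny_sentence/nat_embeds. Qed.

Lemma tiny_ord n : tiny 'I_n.
Proof. by apply: tiny_embeds tiny_nat; exists (@nat_of_ord n); apply: ord_inj. Qed.

Lemma tiny_sum (X Y : Type) : tiny X -> tiny Y -> tiny (X + Y).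
Proof.
move=> [f fi] [g gi].
exists (fun u => [set p | match u, p with
  | inl x, Neg q => f x q
  | inr y, Neg q => g y q
  | inr y, Bot => True
  | _, _ => False end]).
move=> u v E.
have Ebot := congr1 (fun S : set _ => S (Bot _)) E.
have {}E q := congr1 (fun S : set _ => S (Neg q)) E.
move: u v E Ebot => [x|y] [x'|y'] /= E Ebot.
- by congr inl; apply: fi; apply: funext.
- by have : False by rewrite Ebot.
- by have : False by rewrite -Ebot.
- by congr inr; apply: gi; apply: funext.
Qed.

Lemma tiny_small (kappa X : Type) :
  small kappa [set: set (all_formulas L)] -> tiny X -> small kappa [set: X].
Proof.
move=> [kU Uk] [f fi].
have [g gi] : embeds X (set (all_formulas L)).
  apply: (embeds_trans (ex_intro _ f fi)); apply: set_embeds.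
  exists (fun p => existT _ (fctx0 (lsort L)) p) => p q.
  exact: inj_pair2.
have XU : [set: X] #<= [set: set (all_formulas L)].
  by apply: (@set_inj_card_le _ _ _ g) => x y _ _; apply: gi.
split; first exact: card_le_trans XU kU.
by move=> kX; apply: Uk; apply: card_le_trans kX XU.
Qed.

End Count.

(** * Undefined ranks *)

Lemma zermelo (X : Type) : exists W : well_order, wo_car W = X.
Proof.
have [R wR] := wochoice.well_ordering_principle {classic X}.
have minR (A : set X) : A !=set0 -> exists2 z, A z & forall x, A x -> R z x.
  move=> [a Aa]; have [|z [[zA zmin] _]] := wR [pred x | `[< A x >]].
    by exists a; apply/asboolP.
  by exists z; [exact/asboolP|move=> x Ax; apply: zmin; apply/asboolP].
have antiR x y : R x y -> R y x -> x = y.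
  have [z [[_ _] zU]] := wR [pred u | (u == x) || (u == y)] (ex_intro _ x (predU1l _ erefl)).
  have min2 u v : R u v -> R u u -> forall w, w = u \/ w = v -> R u w.
    by move=> uv uu w [->|->].
  have reflR u : R u u by have [|w -> Rw] := minR [set u]; [exists u|exact: Rw].
  move=> xy yx; rewrite -(zU x) ?(zU y) //.
  - by split=> [|u]; rewrite !inE ?eqxx ?orbT // => /orP[]/eqP ->.
  - by split=> [|u]; rewrite !inE ?eqxx ?orbT // => /orP[]/eqP ->.
have totR x y : ~ R x y -> R y x.
  move=> nxy; have [|z] := minR [set u | u = x \/ u = y]; first by exists x; left.
  by case=> -> zm; [case: nxy|]; apply: zm; [right|left].
have tr u v w : ~ R v u -> ~ R w v -> ~ R w u.
  move=> nvu nwv wu; have [|z zA zm] := minR [set x | [\/ x = u, x = v | x = w]].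
    by exists u; constructor 1.
  case: zA zm => -> zm.
  - have uw := antiR _ _ (zm w (Or33 _ _ erefl)) wu; apply: nwv.
    by rewrite -uw; apply: zm; constructor 2.
  - by apply: nvu; apply: zm; constructor 1.
  - by apply: nwv; apply: zm; constructor 2.
have tot v w : [\/ ~ R w v, v = w | ~ R v w].
  have [wv|] := pselect (R w v); last by constructor 1.
  have [vw|] := pselect (R v w); last by constructor 3.
  by constructor 2; apply: antiR.
have wf : well_founded (fun x y : X => ~ R y x).
  move=> x; apply: contrapT => nx.
  have [|z nz zm] := minR [set y | ~ Acc (fun x y : X => ~ R y x) y]; first by exists x.
  by apply: nz; constructor => y zy; apply: contrapT => ny; apply: zy; apply: zm.
by exists (WellOrder tr tot wf).
Qed.

Lemma cantor_collision (X : Type) (f : set X -> X) :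
  exists A B, A <> B /\ f A = f B.
Proof.
apply: contrapT => nf; pose D : set X := [set x | exists2 A, f A = x & ~ A x].
have [DfD|DfD] := pselect (D (f D)); last by apply: (DfD); exists D.
case: (DfD) => A fAD nAD; apply: nf; exists A, D; split=> // AD.
by move: nAD; rewrite AD.
Qed.

Section RankFixpoint.
Variables (L : language) (N : structure L).
Variables (x y : fctx (lsort L)) (z : ctx (lsort L)).
Variables (Delta : set (formula (cat_ctx x y))).
Variables (Pi : set (formula (cat_ctx y z))) (k : nat).

Local Notation step := (@rank_step L N x y z Delta Pi k).

Lemma rank_step_mono (R R' : set (lformula N x)) : R `<=` R' -> step R `<=` step R'.
Proof.
move=> RR' p [d [pi [c [dD pP inf kinc]]]]; exists d, pi, c; split=> //.
by apply: sub_infinite_set inf => a /= [pa /RR'].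
Qed.

Lemma rank_step_sub (R : set (lformula N x)) p : step R p ->
  exists2 q, R q & forall b, lsat q b -> lsat p b.
Proof.
move=> [d [pi [c [_ _ /infinite_setN0 [a [_ Ra]] _]]]].
by exists (And p (inst d a)) => // b [].
Qed.

Variable W : well_order.
Local Notation rk := (@rank_ge L N x y z Delta Pi k W).

Lemma rank_geE w p :
  rk w p <-> @rank_clauses L N x y z Delta Pi k W w (fun v _ => rk v) p.
Proof.
rewrite /rank_ge Fix_eq // => u f g fg.
suff -> : f = g by [].
by apply: functional_extensionality_dep => v; apply: functional_extensionality_dep.
Qed.

Lemma rank_ge_consistent w p : rk w p -> consistent p.
Proof.
elim/(well_founded_ind (@wo_wf W)): w p => w IH p /rank_geE [[_ //]|[[nz _] h]|[v [vw [_ sp]]]].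
  have [v vw] : exists v, wo_lt v w by apply: contrapT.
  exact: IH vw p (h v vw).
have [q qR qp] := rank_step_sub sp; have [b qb] := IH v vw q qR.
by exists b; apply: qp.
Qed.

(** This makes ranks descend. At a successor it follows from monotonicity of the step; at a limit
    [w], from the inclusion of [rk w] in every earlier [rk v]. *)
Lemma rank_step_ge w : step (rk w) `<=` rk w.
Proof.
elim/(well_founded_ind (@wo_wf W)): w => w IH p sp; apply/rank_geE.
have [wz|nz] := pselect (is_zero w).
  constructor 1; split=> //; have [q /rank_ge_consistent [b qb] qp] := rank_step_sub sp.
  by exists b; apply: qp.
have [[v vw]|nv] := pselect (exists v, is_succ v w).
  have rw q : rk w q -> step (rk v) q.
    move=> /rank_geE [[]//|[[_ []]]|[v' [v'w [sv' sq]]]]; first by exists v.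
    suff -> : v = v' by [].
    case: (@wo_total W v v') => // vv'; first by case: vw.2; exists v'.
    by case: sv'.2; exists v; split; last exact: vw.1.
  constructor 3; exists v, vw.1; split=> //.
  by apply: rank_step_mono sp => q /rw; apply: IH vw.1 q.
have lw : is_limit w by [].
constructor 2; split=> // v vw; apply: (IH v vw p).
apply: rank_step_mono sp => q /rank_geE [[]//|[_ /(_ v vw)]//|[v' [_ [sv' _]]]].
by case: nv; exists v'.
Qed.

Lemma rank_ge_anti v w : wo_lt v w -> rk w `<=` rk v.
Proof.
elim/(well_founded_ind (@wo_wf W)): w v => w IH v vw p /rank_geE [[wz _]|[_ h]|[u [uw [su sp]]]].
- by case: wz; exists v.
- exact: h.
- case: (@wo_total W v u) => vu.
  + exact: IH uw v vu p (rank_step_ge sp).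
  + by rewrite vu; apply: rank_step_ge.
  + by case: su.2; exists v.
Qed.

(** The immediate successor [u] of [v] is at most [w], so [rk w] is contained in [rk u], which is
    the step of [rk v]. *)
Lemma rank_ge_stable v w : wo_lt v w -> rk v = rk w -> rk v `<=` step (rk v).
Proof.
move=> vw vwE.
have [u [vu umin]] : exists u, wo_lt v u /\ forall u', wo_lt v u' -> ~ wo_lt u' u.
  apply: contrapT => nu; move: vw {vwE}.
  elim/(well_founded_ind (@wo_wf W)): w => w IH vw; apply: nu; exists w; split=> // u' vu' u'w.
  exact: IH u'w vu'.
move=> p; rewrite {1}vwE => wp.
have : rk u p.
  case: (@wo_total W u w) => uw; [exact: rank_ge_anti uw p wp|by rewrite uw|].
  by case: (umin _ vw).
move=> /rank_geE [[uz _]|[[_ nsu] _]|[v' [v'u [sv' sp]]]].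
- by case: uz; exists v.
- by case: nsu; exists v; split=> // -[u' [vu' u'u]]; apply: umin vu' u'u.
suff -> : v = v' by [].
case: (@wo_total W v v') => // vv'; first by case: (umin _ vv').
by case: sv'.2; exists v.
Qed.

End RankFixpoint.

(** By Cantor's theorem two members of a long enough well-order give the same
    set of formulas, and from there on the sets are stationary. *)
Lemma rank_undefined_fixpoint (L : language) (N : structure L)
    (x y : fctx (lsort L)) (z : ctx (lsort L))
    (Delta : set (formula (cat_ctx x y))) (Pi : set (formula (cat_ctx y z)))
    (k : nat) (p : lformula N x) :
  ~ rank_defined Delta Pi k p ->
  exists R : set (lformula N x), [/\ R p, R `<=` @consistent L N x &
    R `<=` rank_step Delta Pi k R].
Proof.
(* The well-order is one power set larger than the type of the values of [rank_ge], which forces two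
   of them to coincide. *)
move=> np; have [W WE] := zermelo (set (set (lformula N x))).
have allp w : rank_ge (W := W) Delta Pi k w p.
  by apply: contrapT => nw; apply: np; exists W, w.
have [v [w [vw rvw]]] : exists v w, v <> w /\
    rank_ge (W := W) Delta Pi k (N := N) v = rank_ge (W := W) Delta Pi k w.
  move: (rank_ge _ _ _ (W := W)) => f; move: f; rewrite WE.
  exact: cantor_collision.
wlog vw' : v w vw rvw / wo_lt v w => [H|].
  case: (@wo_total W v w) => // [vw'|wv]; first exact: H vw'.
  by apply: H wv; [exact: nesym|].
exists (rank_ge Delta Pi k v); split=> //.
- by move=> q; apply: rank_ge_consistent.
- exact: rank_ge_stable vw' rvw.
Qed.

(** * Long chains *)

Lemma infinite_inj (X : Type) (A : set X) :
  infinite_set A -> exists f : nat -> X, injective f /\ forall n, A (f n).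
Proof.
move=> /infiniteP /card_leP [f].
pose v n : set_type [set: nat] := SigSub (mem_set (I : [set: nat] n)).
exists (fun n => val (f (v n))); split=> [m n /val_inj fmn|n].
  have : v m = v n by apply: (@inj _ _ _ f); rewrite ?inE.
  by move=> /(congr1 val).
exact: set_valP.
Qed.

Lemma infinite_at_least (X : Type) (A : set X) k :
  infinite_set A -> at_least k A.
Proof.
move=> /infinite_inj [f [fi fA]]; exists (fun i => f i); split=> // i j /fi.
exact: ord_inj.
Qed.

Lemma at_least_infinite (X : Type) (A : set X) :
  (forall k, at_least k A) -> infinite_set A.
Proof.
move=> hA /(@finite_seqP {classic X}) [s As].
have [u [ui uA]] := hA (size s).+1.
have := @uniq_leq_size {classic X} [seq u i | i <- enum 'I_(size s).+1] s.
rewrite map_inj_uniq ?enum_uniq // size_map size_enum_ord ltnn => /(_ isT) h.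
have : false by apply: h => _ /mapP [i _ ->]; have := uA i; rewrite As.
by [].
Qed.

Lemma avoid_finite (X Y : Type) (A : set X) (Bad : Y -> set X) (s : seq Y) :
  infinite_set A -> (forall t, List.In t s -> finite_set (Bad t)) ->
  exists2 a, A a & forall t, List.In t s -> ~ Bad t a.
Proof.
move=> iA fB; have fU : finite_set (\bigcup_(t in [set t | List.In t s]) Bad t).
  by apply: bigcup_finite => //; apply: list_finite.
set U := \bigcup_(t in _) _ in fU.
have [a [Aa na]] : (A `\` U) !=set0.
  apply: infinite_setN0 => fD; apply: iA.
  have : finite_set ((A `\` U) `|` U) by rewrite finite_setU.
  apply: sub_finite_set => a Aa.
  by have [Ua|nUa] := pselect (U a); [right|left].
by exists a => // t ts Bta; apply: na; exists t.
Qed.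

Section Ordered.
Variables (I : Type) (below : I -> I -> Prop).
Hypothesis below_wf : well_founded below.

Lemma wf_minimal (A : set I) : A !=set0 ->
  exists2 i, A i & forall j, A j -> ~ below j i.
Proof.
move=> [i0]; elim/(well_founded_ind below_wf): i0 => i IH Ai.
have [[j [Aj ji]]|nj] := pselect (exists j, A j /\ below j i); first exact: IH ji Aj.
by exists i => // j Aj ji; apply: nj; exists j.
Qed.

Lemma wf_irreflexive i : ~ below i i.
Proof.
by have [|j -> jm] := @wf_minimal [set i]; [exists i|exact: jm].
Qed.

Fixpoint ordered (l : seq I) : Prop :=
  match l with
  | [::] => True
  | i :: l => (forall j, List.In j l -> j <> i /\ ~ below j i) /\ ordered l
  end.

(** Minimal indices are listed first, so that when an index is treated, none below it is still to
    come. *)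
Lemma exists_ordered (F : seq I) :
  exists2 l, ordered l & forall i, List.In i F -> List.In i l.
Proof.
have [n] := ubnP (size F); elim: n F => // n IH [_|i0 F0]; first by exists [::].
set F := i0 :: F0 => Fn.
have [|i iF imin] := @wf_minimal [set i | List.In i F]; first by exists i0; left.
pose F' := [seq j <- F | `[< j <> i >]].
have [|l ol lF] := IH F'.
  rewrite (leq_trans _ (ltnSE Fn)) // ltn_neqAle size_filter count_size andbT.
  rewrite -all_count; apply/negP; elim: (F) iF => //= j F1 IH1 [->|iF1] /andP[].
    by move/asboolP.
  by move=> _; apply: IH1.
exists (i :: [seq j <- l | `[< j <> i /\ List.In j F >]]).
  split=> [j /filter_In [_ [ji jF]]|]; first by split=> //; apply: imin.
  elim: (l) ol => //= j l1 IHl [jl ol]; case: asboolP => [jF|_]; last exact: IHl.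
  by split; [move=> j' /filter_In [/jl]|exact: IHl].
move=> j jF; have [->|ji] := pselect (j = i); first by left.
by right; apply/filter_In; split=> //; apply: lF; apply/filter_In.
Qed.

End Ordered.

Section Chain.
Variables (L : language) (N : structure L).
Variables (x y : fctx (lsort L)) (z : ctx (lsort L)).
Variables (I : Type) (below : I -> I -> Prop).
Hypothesis below_wf : well_founded below.

Variable Thetas : seq (set (asg N (cat_ctx x (cat_ctx y z)))).
Hypothesis Thetas_definable : forall Th, List.In Th Thetas -> definable Th.

Definition holds_some (b : asg N x) (a : asg N y) (c : asg N z) :=
  exists2 Th, List.In Th Thetas & Th (cat_asg b (cat_asg a c)).

Definition chain_ctx : ctx (lsort L) :=
  Ctx (I * (cvar y + cvar z)) (fun w => csort (c := cat_ctx y z) w.2).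

Definition chain_a (E : asg N chain_ctx) (i : I) : asg N y := fun j => E (i, inl j).
Definition chain_c (E : asg N chain_ctx) (i : I) : asg N z := fun j => E (i, inr j).

Definition base_vars (i : I) : set (cvar chain_ctx) :=
  [set w | below w.1 i \/ w.1 = i /\ exists j, w.2 = inr j].

Definition chain_base (E : asg N chain_ctx) (i : I) :
    asg N (sub_ctx (base_vars i)) := restr E.
Arguments chain_base : clear implicits.

Definition bounded_family G (th : set (asg N (cat_ctx y G))) (k : nat) :=
  definable th /\ forall d, ~ at_least k (fun a => th (cat_asg a d)).

(** The conditions [independent_at i] together say that a_i is not algebraic over
    c_i and the pairs (a_j, c_j) with j below i. *)
Definition independent_at (i : I) : set (set (asg N chain_ctx)) :=
  [set Y | exists th k, bounded_family th k /\
     Y = fun E => ~ th (cat_asg (chain_a E i) (chain_base E i))].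

(** Stands for the solution sets of the formulas in a fixpoint of [rank_step]. *)
Variable R : set (set (asg N x)).
Hypothesis R_consistent : forall P, R P -> P !=set0.
Hypothesis R_step : forall P, R P -> exists c, infinite_set [set a | exists P',
  [/\ R P', P' `<=` P & forall b, P' b -> holds_some b a c]].

Lemma definable_holds_some i : definable (fun e : asg N (cat_ctx x chain_ctx) =>
  holds_some (lasg e) (chain_a (rasg e) i) (chain_c (rasg e) i)).
Proof.
apply: definable_ex_in => Th /Thetas_definable; apply: definable_subst.
apply: is_subst_cat; first by auto.
by apply: is_subst_cat => v;
  [exists (@Var _ (cat_ctx x chain_ctx) (inr (i, inl v)))
  |exists (@Var _ (cat_ctx x chain_ctx) (inr (i, inr v)))].
Qed.

Lemma definable_independent i Y : independent_at i Y ->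
  definable (fun e : asg N (cat_ctx x chain_ctx) => Y (rasg e)).
Proof.
move=> [th [k [[dth _] ->]]]; apply: definable_not; apply: definable_subst dth.
apply: is_subst_cat => v.
  by exists (@Var _ (cat_ctx x chain_ctx) (inr (i, inl v))).
by exists (@Var _ (cat_ctx x chain_ctx) (inr (sval v))).
Qed.

Definition update_at (E : asg N chain_ctx) (i : I) (a : asg N y) (c : asg N z) :
    asg N chain_ctx :=
  fun w => if pselect (w.1 = i) then cat_asg a c w.2 else E w.

Lemma independent_agree i Y (E E' : asg N chain_ctx) :
  independent_at i Y -> (forall w, w.1 = i \/ below w.1 i -> E w = E' w) ->
  Y E -> Y E'.
Proof.
move=> [th [k [_ ->]]] EE'.
have -> : chain_a E i = chain_a E' i.
  by apply: functional_extensionality_dep => j; apply: (EE' (i, inl j)); by left.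
have -> // : chain_base E i = chain_base E' i.
apply: functional_extensionality_dep => -[w [wi|[wi wz]]]; apply: (EE' w); [by right|by left].
Qed.

(** The base at [i] consists of [c] and of values at indices below [i], hence different from [i]; it
    does not move with a, and the bound of the family applies. *)
Lemma finite_dependent i Y E c : independent_at i Y ->
  finite_set [set a | ~ Y (update_at E i a c)].
Proof.
move=> [th [k [[_ hk] ->]]]; apply: contrapT => inf.
have [a0 _] := infinite_setN0 inf.
apply: (hk (chain_base (update_at E i a0 c) i)); apply: infinite_at_least.
apply: sub_infinite_set inf => a /= /contrapT.
have -> : chain_a (update_at E i a c) i = a.
  by apply: functional_extensionality_dep => j; rewrite /chain_a /update_at; case: pselect.
have -> // : chain_base (update_at E i a c) i = chain_base (update_at E i a0 c) i.
apply: functional_extensionality_dep => -[[j v] /=]; rewrite /chain_base /restr /update_at /=.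
move=> [/= ji|[/= ji [u /= vu]]].
  by case: pselect => // ij; subst j; case: (wf_irreflexive below_wf ji).
by move: vu => /= vu; subst v; case: pselect.
Qed.

(** The head [i] is served first: its a comes from the infinite set of [R_step] and avoids the
    finitely many bad values for the conditions in [s]. Later choices only shrink [P] and change
    neither the values at [i] nor those below it, so both demands persist. *)
Lemma finite_chain (s : seq (set (asg N chain_ctx))) (l : seq I) :
  ordered below l -> forall P (E : asg N chain_ctx), R P ->
  exists P' E', [/\ R P', P' `<=` P, forall w, ~ List.In w.1 l -> E' w = E w &
    forall i, List.In i l ->
      (forall b, P' b -> holds_some b (chain_a E' i) (chain_c E' i)) /\
      (forall Y, List.In Y s -> independent_at i Y -> Y E')].
Proof.
elim: l => [_|i l IH [il ol]] P E RP; first by exists P, E; split.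
have [c infA] := R_step RP.
pose s' := [seq Y <- s | `[< independent_at i Y >]].
have [|a [P1 [RP1 P1P hP1]] ha] := @avoid_finite _ _ _
  (fun Y => [set a | ~ Y (update_at E i a c)]) s' infA.
  by move=> Y /filter_In [_ iY]; apply: finite_dependent.
have [P' [E' [RP' P'P1 E'E hE']]] := IH ol P1 (update_at E i a c) RP1.
have nil : ~ List.In i l by move=> /il [].
exists P', E'; split=> //.
- by move=> b /P'P1 /P1P.
- move=> w /not_orP [wi wl]; rewrite E'E // /update_at.
  by case: pselect => // iw; case: wi.
move=> j [<-|/hE' //]; split=> [b /P'P1 /hP1|Y Ys iY].
  have -> : chain_a E' i = a.
    apply: functional_extensionality_dep => v; rewrite /chain_a E'E // /update_at.
    by case: pselect.
  have -> // : chain_c E' i = c.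
  apply: functional_extensionality_dep => v; rewrite /chain_c E'E // /update_at.
  by case: pselect.
apply: (independent_agree iY _ (contrapT _)) => [w wi|nY].
  rewrite E'E // => wl; case: wi => wi; first by apply: nil; rewrite -wi.
  by case: (il _ wl).
have Ys' : List.In Y s' by apply/filter_In.
exact: (ha Y Ys' nY).
Qed.

Lemma chain_exists : R !=set0 -> compact_in N (cat_ctx x chain_ctx) ->
  exists b E, forall i, holds_some b (chain_a E i) (chain_c E i) /\
    forall Y, independent_at i Y -> Y E.
Proof.
move=> [P RP] cpt.
pose Gam : set (set (asg N (cat_ctx x chain_ctx))) := [set X | exists i,
  X = (fun e => holds_some (lasg e) (chain_a (rasg e) i) (chain_c (rasg e) i)) \/
  exists2 Y, independent_at i Y & X = fun e => Y (rasg e)].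
have [||e [_ he]] := cpt Gam set0.
- move=> X [i [->|[Y iY ->]]]; first exact: definable_holds_some.
  exact: definable_independent iY.
- move=> s sG.
  have [F [t Ft]] : exists (F : seq I) (t : seq (set (asg N chain_ctx))),
      forall X, List.In X s -> exists2 i, List.In i F &
       X = (fun e => holds_some (lasg e) (chain_a (rasg e) i) (chain_c (rasg e) i)) \/
       exists2 Y, independent_at i Y & List.In Y t /\ X = fun e => Y (rasg e).
    elim: s sG => [|X s IH] sG; first by exists [::], [::].
    have [|F [t Ft]] := IH; first by move=> X' X's; apply: sG; right.
    have [i hi] := sG X (or_introl erefl).
    have weak t' : (forall Y, List.In Y t -> List.In Y t') ->
        forall X, List.In X s -> exists2 j, List.In j (i :: F) &
       X = (fun e => holds_some (lasg e) (chain_a (rasg e) j) (chain_c (rasg e) j)) \/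
       exists2 Y, independent_at j Y & List.In Y t' /\ X = fun e => Y (rasg e).
      move=> tt' X' /Ft [j jF [hj|[Y iY [Yt XY]]]]; exists j; try by right.
        by left.
      by right; exists Y => //; split=> //; apply: tt'.
    case: hi => [hX|[Y iY XY]].
      exists (i :: F), t => X' [<-|/(weak t) //]; last exact.
      by exists i; [left|left].
    exists (i :: F), (Y :: t) => X' [<-|/(weak (Y :: t))].
      by exists i; [left|right; exists Y => //; split=> //; left].
    by apply=> Y' Y't; right.
  have [l ol lF] := exists_ordered below_wf F.
  (* Sorts may be empty; this pair fills the indices outside [l]. *)
  have [c /infinite_setN0 [a _]] := R_step RP.
  have [P' [E [RP' _ _ hE]]] := finite_chain t ol
    (fun w => cat_asg a c w.2 : N (csort (c := chain_ctx) w)) RP.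
  have [b P'b] := R_consistent RP'.
  exists (@cat_asg _ N x chain_ctx b E); split=> // X /Ft [i /lF /hE [hi hi'] [->|[Y iY [Yt ->]]]].
    exact: hi.
  exact: hi'.
exists (lasg e), (rasg e) => i; split.
  apply: (he (fun e => holds_some (lasg e) (chain_a (rasg e) i) (chain_c (rasg e) i))).
  by exists i; left.
by move=> Y iY; apply: (he (fun e => Y (rasg e))); exists i; right; exists Y.
Qed.

End Chain.

(** * Algebraicity and strong dividing *)

Lemma uniq_enum (X : Type) (A : set X) : finite_set A ->
  exists n (h : 'I_n -> X), injective h /\ range h = A.
Proof.
move=> /(@finite_seqP {classic X}) [s0 ->]; pose s := undup s0.
exists (size s), (fun i => tnth (in_tuple s) i); split.
  by have /tuple_uniqP := undup_uniq s0 : uniq (in_tuple s).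
apply/seteqP; split=> [_ [i _ <-]|v] /=.
  by rewrite -mem_undup; apply: mem_tnth.
by rewrite -mem_undup => /(tnthP (in_tuple s)) [i ->]; exists i.
Qed.

Section Algebraic.
Variables (L : language) (N : structure L).
Implicit Types y u : fctx (lsort L).

(** The bound is required at all parameters, not just at the given ones. This is no loss: a formula
    can be conjoined with a bound on the number of its solutions, as in [bounded_at_least]. *)
Definition algebraic y u W (a : asg N y) (t : asg N u) (D : asg N W) :=
  exists th k, bounded_family (G := cat_ctx u W) th k /\
    th (cat_asg a (cat_asg t D)).

(** The bound [k.+1] guarantees a member of the fibre even for k = 0, and that member carries the
    condition of having fewer than k solutions. *)
Lemma bounded_at_least y G (X : set (asg N (cat_ctx y G))) k :
  definable X ->
  bounded_family (fun c => X c /\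
    ~ at_least k (fun a => X (cat_asg a (rasg c)))) k.+1.
Proof.
move=> dX; split.
  apply: definable_and => //; apply: definable_not.
  have dA := definable_at_least k (fctx_finite y) dX.
  by apply: definable_subst dA; auto.
move=> d h; have /at_leastS [a [_ na] _] := h.
by apply: na; apply: at_leastW; apply: at_least_sub h => a' [].
Qed.

(** Compactness is applied to infinitely many distinct rows of variables that satisfy all that [a]
    satisfies over [t] and [D]. A finite part amounts to a single [X]; were its solutions bounded in
    number, [a] would be algebraic. *)
Lemma not_algebraic_realizations y u W (a : asg N y) (t : asg N u) (D : asg N W) :
  compact_in N (cat_ctx (Ctx (nat * cvar y) (fun w => csort w.2)) (cat_ctx u W)) ->
  ~ algebraic a t D ->
  exists g : nat -> asg N y, injective g /\
    forall n (X : set (asg N (cat_ctx y (cat_ctx u W)))), definable X ->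
      X (cat_asg a (cat_asg t D)) -> X (cat_asg (g n) (cat_asg t D)).
Proof.
set V := Ctx _ _; set G := cat_ctx V _ => cpt nalg.
pose tD : asg N (cat_ctx u W) := cat_asg t D.
pose row (e : asg N G) n : asg N y := fun j => e (inl (n, j)).
have row_subst n : is_subst (fun e => row e n).
  by move=> j; exists (@Var _ G (inl (n, j))).
pose Gam : set (set (asg N G)) := [set S |
  (exists n X, [/\ definable X, X (cat_asg a tD) & S = fun e => X (cat_asg (row e n) (rasg e))]) \/
  (exists n m, n <> m /\ S = fun e => ~ (row e n = row e m))].
pose R : set {v : cvar G & N (csort v)} :=
  [set r | exists v : cvar (cat_ctx u W),
     r = existT (fun v : cvar G => N (csort v)) (inr v) (tD v)].
have [||e [Re he]] := cpt Gam R.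
- move=> S [[n [X [dX _ ->]]]|[n [m [_ ->]]]].
    by apply: definable_subst dX; apply: is_subst_cat => //; auto.
  by apply: definable_not; apply: definable_asg_eq => //; apply: fctx_finite.
- move=> s sG.
  have [X [dX Xa hX]] : exists X, [/\ definable X, X (cat_asg a tD) &
      forall g : nat -> asg N y, injective g -> (forall n, X (cat_asg (g n) tD)) ->
      forall S, List.In S s -> S (@cat_asg _ N V _ (fun w => g w.1 w.2) tD)].
    elim: s sG => [|S s IH] sG.
      by exists setT; split=> //; apply: definable_true.
    have [|X [dX Xa hX]] := IH; first by move=> S' S's; apply: sG; right.
    have [[n [X' [dX' X'a SE]]]|[n [m [nm SE]]]] := sG S (or_introl erefl).
      exists (fun c => X' c /\ X c); split=> //; first exact: definable_and.
      move=> g gi hg S' [<-|S's]; first by rewrite SE; case: (hg n).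
      by apply: (hX g gi) => // l; case: (hg l).
    exists X; split=> // g gi hg S' [<-|S's]; last exact: (hX g gi hg).
    by rewrite SE => /gi.
  have inf : infinite_set [set a' | X (cat_asg a' tD)].
    apply: at_least_infinite => k; apply: contrapT => nk; apply: nalg.
    by eexists; exists k.+1; split; first exact: (bounded_at_least k dX).
  have [g [gi hg]] := infinite_inj inf.
  exists (@cat_asg _ N V _ (fun w => g w.1 w.2) tD); split; last exact: (hX g gi hg).
  by move=> _ [v ->].
have eE : rasg e = tD.
  apply: functional_extensionality_dep => v.
  by apply: (Re (existT (fun v : cvar G => N (csort v)) (inr v) (tD v))); exists v.
exists (row e); split.
  move=> n m nm; apply: contrapT => /eqP/eqP nm'.
  by apply: (he (fun e => ~ (row e n = row e m))) nm; right; exists n, m.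
move=> n X dX Xa; rewrite -/tD -eE.
by apply: (he (fun e => X (cat_asg (row e n) (rasg e)))); left; exists n, X.
Qed.

Lemma extend_asg G n (h : 'I_n -> cvar G) (r : asg N (FCtx n (fun i => csort (h i))))
    (e0 : asg N G) : injective h ->
  exists e : asg N G, (forall i, e (h i) = r i) /\
    forall v, ~ range h v -> e v = e0 v.
Proof.
move=> hi; have /dep_choice [e he] (v : cvar G) : exists m : N (csort v),
   (forall i (E : h i = v), m = eq_rect (h i) (fun v => N (csort v)) (r i) v E) /\
   (~ range h v -> m = e0 v).
  have [[i _ hiv]|nv] := pselect (range h v); last first.
    by exists (e0 v); split=> // i E; case: nv; exists i.
  subst v; exists (r i); split=> [j E|]; last by case; exists i.
  by have ij := hi _ _ E; subst j; rewrite (Prop_irrelevance E erefl).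
exists e; split=> [i|v /(proj2 (he v))] //.
by have [/(_ i erefl)] := he (h i).
Qed.

End Algebraic.

(** * Descent of algebraicity along a non-forking type *)

Section Descent.
Variables (L : language) (N : structure L).
Implicit Types y u : fctx (lsort L).

Lemma entries_term G (a : asg N G) (e : elem N) : entries a e ->
  exists t : term G (projT1 e), eval a t = projT2 e.
Proof. by move=> [v _ <-]; exists (Var v). Qed.

Lemma entries_restr G (Q : set (cvar G)) (a : asg N G) :
  entries (restr (Q := Q) a) `<=` entries a.
Proof. by move=> _ [v _ <-]; exists (sval v). Qed.

Lemma entries_pull G n (h : 'I_n -> cvar G) (a : asg N G) :
  entries (G := FCtx n (fun i => csort (h i))) (fun i => a (h i)) `<=` entries a.
Proof. by move=> _ [i _ <-]; exists (h i). Qed.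

Lemma definable_over G D (A : set (elem N)) (b : asg N D)
    (f : lformula N G) : A `<=` entries b -> is_over A f ->
  exists2 X : set (asg N (cat_ctx G D)), definable X &
    forall a, X (cat_asg a b) <-> lsat f a.
Proof.
move=> Ab [w [d [e [eA ->]]]].
have /dep_choice [h hh] : forall v : cvar w, exists t : term D (csort v), eval b t = e v.
  move=> v; have /entries_term [t ht] : entries b (elem_of (e v)).
    by apply/Ab/eA; exists v.
  by exists t.
exists (fun c => sat d (cat_asg (lasg c) (fun v => eval (rasg c) (h v)))).
  apply: (definable_subst (r := fun c => cat_asg (lasg c) (fun v => eval (rasg c) (h v)))).
    apply: is_subst_cat => [|v]; first by auto.
    exists (tsubst (fun w : cvar D => @Var _ (cat_ctx G D) (inr w)) (h v)) => c.
    by rewrite eval_tsubst.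
  exact: definable_sat.
move=> a; rewrite lsat_inst.
suff -> : (fun v => eval (rasg (cat_asg a b)) (h v)) = e by [].
by apply: functional_extensionality_dep => v; rewrite -hh.
Qed.

(** If [a] were algebraic over [t'] and [D] but not over [t] and [D], then the
    formula witnessing the former would strongly divide over [B0] and finitely
    many elements of [D]. *)
Lemma algebraic_descent y u u' W (a : asg N y) (t : asg N u) (t' : asg N u')
    (D : asg N W) (B0 B : set (elem N)) :
  compact_in N (cat_ctx (Ctx (nat * cvar y) (fun w => csort w.2)) (cat_ctx u W)) ->
  B0 `<=` entries t `|` entries D -> entries D `<=` B -> entries a `<=` B ->
  ~ type_thorn_forks (tp t' B) B0 ->
  algebraic a t' D -> algebraic a t D.
Proof.
move=> cpt B0s DB aB nfork [th [k [[dth bth] tha]]].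
apply: contrapT => /(not_algebraic_realizations cpt) [g [gi hg]]; apply: nfork.
have [Q fQ dQ] := definable_support dth.
pose aD := cat_asg a D : asg N (cat_ctx y W).
(* Strong dividing takes finite tuples, whereas [D] may be infinite. Only the coordinates of [D] in
   the support of [th] enter the parameter [pull aD]; listed again as [c] and added to the base,
   they stay fixed, and conjugation moves [a] alone. *)
pose QW : set (cvar W) := [set w | Q (inr (inr w))].
have fQW : finite_set QW by apply: finite_preimage fQ => v w _ _ [].
pose Q' : set (cvar (cat_ctx y W)) := [set v | match v with inl _ => True | inr w => QW w end].
have fQ' : finite_set Q'.
  rewrite (_ : Q' = (inl @` setT) `|` (inr @` QW)).
    by rewrite finite_setU; split; apply: finite_image => //; apply: (fctx_finite y).
  apply/seteqP; split=> -[v|v] /=.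
  - by left; exists v.
  - by right; exists v.
  - by [].
  - by move=> [[]|[w Qw [<-]]].
have [n [h [hi hQ']]] := uniq_enum fQ'.
have [m [hW [_ hWQ]]] := uniq_enum fQW.
pose y' := FCtx n (fun i => csort (h i)).
pose pull (e : asg N (cat_ctx y W)) : asg N y' := fun i => e (h i).
pose z := FCtx m (fun i => csort (hW i)).
pose c : asg N z := fun i => D (hW i).
have hl j : exists i, h i = inl j.
  by have : Q' (inl j) by []; rewrite -hQ' => -[i _ <-]; exists i.
have hr w : QW w -> exists i, h i = inr w.
  by move=> Qw; have : Q' (inr w) by []; rewrite -hQ' => -[i _ <-]; exists i.
have cD : entries c `<=` entries D by apply: entries_pull.
(* psi(x'; y') is th with the variables of y and W listed in y' *)
have [psi hpsi] : exists psi : formula (cat_ctx u' y'), forall b (e : asg N (cat_ctx y W)),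
    sat psi (cat_asg b (pull e)) <-> th (cat_asg (lasg e) (cat_asg b (rasg e))).
  have [p hp] := dQ.
  have tm v : Q v -> exists s : term (cat_ctx u' y') (csort v), forall b (e : asg N (cat_ctx y W)),
      eval (cat_asg b (pull e)) s = cat_asg (lasg e) (cat_asg b (rasg e)) v.
    have var i v' : h i = v' -> exists s : term (cat_ctx u' y') (csort v'),
        forall b (e : asg N (cat_ctx y W)), eval (cat_asg b (pull e)) s = e v'.
      by move=> <-; exists (@Var _ (cat_ctx u' y') (inr i)).
    case: v => [j|[v|w]] Qv.
    - by have [i /var] := hl j.
    - by exists (@Var _ (cat_ctx u' y') (inl v)).
    - by have [i /var] := hr w Qv.
  have /dep_choice [s hs] := fun v : cvar (sub_ctx Q) => tm (sval v) (svalP v).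
  exists (fsubst s p) => b e; rewrite sat_fsubst -hp.
  rewrite (_ : (fun v => _) = restr (cat_asg (lasg e) (cat_asg b (rasg e)))) //.
  by apply: functional_extensionality_dep => v; rewrite hs.
have pull_inj a1 a2 : pull (cat_asg a1 D) = pull (cat_asg a2 D) -> a1 = a2.
  move=> E; apply: functional_extensionality_dep => j; have [i hij] := hl j.
  have key v : h i = v -> cat_asg a1 D v = cat_asg a2 D v.
    by move=> <-; exact: (congr1 (fun r : asg N y' => r i) E).
  exact: (key _ hij).
exists (inst psi (pull aD)); split.
  move=> b; apply; split; last by apply/lsat_inst/hpsi.
  exists y', psi, (pull aD); split=> // e /(@entries_pull _ _ h) [[j|w] _ <-].
    by apply: aB; exists j.
  by apply: DB; exists w.
exists 1, (fun _ => y'), (fun _ => psi), (fun _ => pull aD); split; last first.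
  by move=> b pb; exists ord0.
move=> _; exists z, c; set C := B0 `|` entries c.
have CtD : C `<=` entries (cat_asg t D).
  move=> e [/B0s [[v _ <-]|[v _ <-]]|/cD [v _ <-]].
  - by exists (inl v).
  - by exists (inr v).
  - by exists (inr v).
split.
  apply: at_least_infinite => l; exists (fun i : 'I_l => pull (cat_asg (g i) D)); split.
    by move=> i j /pull_inj /gi; apply: ord_inj.
  move=> i f [fC fa]; have [X dX hX] := definable_over CtD fC.
  pose r (e : asg N (cat_ctx y (cat_ctx u W))) : asg N (cat_ctx y' (cat_ctx u W)) :=
    cat_asg (pull (cat_asg (lasg e) (rasg (rasg e)))) (rasg e).
  have sr : is_subst r.
    apply: is_subst_cat; last by auto.
    have sc : is_subst (fun e : asg N (cat_ctx y (cat_ctx u W)) =>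
      cat_asg (lasg e) (rasg (rasg e))).
      by auto.
    by move=> v; apply: (sc (h v)).
  by apply/hX; apply: (hg i _ (definable_subst sr dX)); apply/hX.
exists k => rs rsi rsC [b hb].
(* The formulas fixing the coordinates of [c] belong to the type over [C], so each conjugate
   consists of some a' and the same part of [D]. *)
have /dep_choice [as_ has] (i : 'I_k) : exists a', rs i = pull (cat_asg a' D).
  have fixed l w : h l = inr w -> rs i l = aD (h l).
    move=> hlw; pose w1 := FCtx 1 (fun _ => csort (h l)).
    pose d : formula (cat_ctx y' w1) := Equal (@Var _ (cat_ctx y' w1) (inl l))
      (@Var _ (cat_ctx y' w1) (inr ord0)).
    have /lsat_inst // : lsat (inst d (fun _ => aD (h l) : N (csort (c := w1) ord0))) (rs i).
    apply: rsC; split; last exact/lsat_inst.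
    exists w1, d, (fun _ => aD (h l)); split=> // _ [o _ <-]; right.
    have Qw : QW w.
      by have : range h (inr w); [exists l|rewrite hQ'].
    have [l' _ hl'] : range hW w by rewrite hWQ.
    exists l' => //.
    have keyW v : hW l' = v -> elem_of (D (hW l')) = elem_of (D v) by move=> <-.
    have key v : h l = v -> elem_of (aD v) = elem_of (aD (h l)) by move=> <-.
    exact: (etrans (keyW _ hl') (key _ hlw)).
  have [e [eh en]] := extend_asg (rs i) aD hi.
  exists (lasg e); apply: functional_extensionality_dep => l; rewrite -eh /pull.
  have key v : h l = v -> e v = cat_asg (lasg e) D v.
    case: v => // w hlw /=; have := fixed l w hlw; rewrite -eh.
    have key v : h l = v -> e (h l) = aD (h l) -> e v = aD v by move=> <-.
    exact: key hlw.
  exact: key.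
(* One [b] satisfying k distinct instances would give k elements in the fibre of [th] over [b] and
   [D]. *)
apply: (bth (cat_asg b D)); exists as_; split=> [i j|i].
  by move=> asij; apply: rsi; rewrite !has asij.
have /hpsi : sat psi (cat_asg b (pull (cat_asg (as_ i) D))) by rewrite -has; apply: hb.
exact.
Qed.

End Descent.

(** * The theorem *)

Lemma card_le_enum (X Y : Type) (A : set X) : A #<= [set: Y] ->
  exists e : Y -> option X, forall x, A x -> exists i, e i = Some x.
Proof.
move=> /ocard_geP /surjPex [e he]; exists e => x Ax.
by have [|i _ ei] := he (Some x); [exists x|exists i].
Qed.

(** Each [A m] is enumerated by formulas, and the sentence [And (cn m) (cf p)] codes the place of an
    element in these enumerations. A node with one branch per sentence thus collects the indices
    from all the sets at once; sentences that code nothing get a leaf. *)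
Lemma index_bound (L : language) (X : Type) (A : nat -> set X) (g : X -> itree L) :
  (forall m, A m #<= [set: all_formulas L]) ->
  exists j, forall m e, A m e -> below (g e) j.
Proof.
move=> cA; have /dep_choice [h hh] := fun m => card_le_enum (cA m).
have [cn cni] := nat_embeds L; have [cf cfi] := all_formulas_embeds_sentence L.
have /dep_choice [f hf] : forall s, exists i : itree L, forall m p e,
    And (cn m) (cf p) = s -> h m p = Some e -> g e = i.
  move=> s; have [[m [p [e [<- hmp]]]]|ns] :=
    pselect (exists m p e, And (cn m) (cf p) = s /\ h m p = Some e).
    by exists (g e) => m' p' e' [/cni -> /cfi ->]; rewrite hmp => -[->].
  by exists (Leaf L) => m p e ms hmp; case: ns; exists m, p, e.
exists (Sup f) => m e /hh [p hp]; exists (And (cn m) (cf p)).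
by rewrite (hf _ m p e erefl hp).
Qed.

Lemma finite_sub_tiny (L : language) (X : Type) (Q : set X) :
  finite_set Q -> tiny L {x | Q x}.
Proof.
move=> /uniq_enum [n [h [_ hQ]]]; apply: tiny_embeds (tiny_ord L n).
have /dep_choice [f hf] (x : {x | Q x}) : exists i, h i = sval x.
  by case: x => x /=; rewrite -hQ => -[i _ <-]; exists i.
by exists f => x x' fx; apply: sval_inj; rewrite -!hf fx.
Qed.

Section FiniteParameters.
Variables (L : language) (N : structure L).

(** The variables [z] may outnumber [kappa], while compactness is available for tiny contexts. Each
    pair of the chain keeps only the finitely many variables that [Pi] mentions. *)
Lemma finite_parameter_support (y : fctx (lsort L)) (z : ctx (lsort L))
    (Pi : set (formula (cat_ctx y z))) : finite_set Pi ->
  exists2 Qz : set (cvar z), finite_set Qz & forall pi, Pi pi ->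
    exists2 X : set (asg N (cat_ctx y (sub_ctx Qz))), definable X &
      forall a c, sat pi (cat_asg a c) <-> X (cat_asg a (restr c)).
Proof.
move=> fPi; have /dep_choice [Q hQ] : forall pi : formula (cat_ctx y z),
    exists Q, finite_set Q /\ definable_on Q (sat (N := N) pi).
  by move=> pi; have [Q] := formula_support N pi; exists Q.
exists (\bigcup_(pi in Pi) [set w | Q pi (inr w)]).
  apply: bigcup_finite => // pi _; have [fQ _] := hQ pi.
  by apply: finite_preimage fQ => v w _ _ [].
move=> pi Pipi; set Qz := \bigcup_(_ in _) _.
have [_ [p hp]] := hQ pi.
have /dep_choice [h hh] : forall v : cvar (sub_ctx (Q pi)),
    exists t : term (cat_ctx y (sub_ctx Qz)) (csort v), forall (a : asg N y) (c : asg N z),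
      eval (cat_asg a (restr (Q := Qz) c)) t = cat_asg a c (sval v).
  case=> -[j|w] Qv; first by exists (@Var _ (cat_ctx y (sub_ctx Qz)) (inl j)).
  have Qzw : Qz w by exists pi.
  by exists (@Var _ (cat_ctx y (sub_ctx Qz)) (inr (exist _ w Qzw))).
exists (sat (fsubst h p)); first exact: definable_sat.
move=> a c; rewrite sat_fsubst -hp.
rewrite (_ : (fun v => _) = restr (cat_asg a c)) //.
by apply: functional_extensionality_dep => v; rewrite hh.
Qed.

(** The choice of (delta, pi) may change from one step of the rank to the next;
    as there are finitely many pairs, "some pair works" is still definable.  The
    variables z, possibly infinite in number, are cut down to those in [Pi]. *)
Lemma fixpoint_chain_data (x y : fctx (lsort L)) (z : ctx (lsort L))
    (Delta : set (formula (cat_ctx x y))) (Pi : set (formula (cat_ctx y z)))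
    (k : nat) (G : set (lformula N x)) :
  finite_set Delta -> finite_set Pi -> G `<=` rank_step Delta Pi k G ->
  exists (Qz : set (cvar z)) (Thetas : seq (set (asg N (cat_ctx x (cat_ctx y (sub_ctx Qz)))))),
  [/\ finite_set Qz,
      forall Th, List.In Th Thetas -> definable Th,
      forall Th, List.In Th Thetas -> exists l, forall b c,
        ~ at_least l (fun a => Th (cat_asg b (cat_asg a c))) &
      forall p, G p -> exists c, infinite_set [set a | exists q,
        [/\ G q, lsat q `<=` lsat p &
          forall b, lsat q b -> holds_some Thetas b a c]]].
Proof.
move=> /finite_list [lD hD] fPi Gstep.
have [Qz fQz hQz] := finite_parameter_support fPi.
have [lP hP] := finite_list fPi.
have /dep_choice [X hX] : forall pi, exists X : set (asg N (cat_ctx y (sub_ctx Qz))), Pi pi ->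
    definable X /\ forall a c, sat pi (cat_asg a c) <-> X (cat_asg a (restr c)).
  move=> pi; have [/hQz [X dX sX]|nP] := pselect (Pi pi); first by exists X.
  by exists setT.
pose A d pi (e : asg N (cat_ctx y (cat_ctx x (sub_ctx Qz)))) :=
  sat d (cat_asg (lasg (rasg e)) (lasg e)) /\
  X pi (cat_asg (lasg e) (rasg (rasg e))).
(* The second conjunct is the first-order trace of k-inconsistency. It bounds the fibres at every b
   and c, beyond the c supplied by the rank, and this makes the algebraicity uniform. *)
pose Th (dpi : formula (cat_ctx x y) * formula (cat_ctx y z))
    (e : asg N (cat_ctx x (cat_ctx y (sub_ctx Qz)))) :=
  A dpi.1 dpi.2 (cat_asg (lasg (rasg e)) (cat_asg (lasg e) (rasg (rasg e)))) /\
  ~ at_least k (fun a => A dpi.1 dpi.2 (cat_asg a (cat_asg (lasg e) (rasg (rasg e))))).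
exists Qz, [seq Th dpi | dpi <- List.list_prod lD lP]; split=> //.
- move=> _ /List.in_map_iff [[d pi] [<- /List.in_prod_iff [_ piP]]].
  have [|dX _] := hX pi; first by rewrite hP.
  have dA : definable (A d pi).
    apply: definable_and; first by apply: definable_subst (definable_sat N d); auto.
    by apply: definable_subst dX; auto.
  apply: definable_and; first by apply: definable_subst dA; auto 10.
  apply: definable_not.
  by apply: definable_subst (definable_at_least k (fctx_finite y) dA); auto.
- move=> _ /List.in_map_iff [[d pi] [<- _]]; exists k.+1 => b c h.
  have /at_leastS [a [_ na] _] := h; apply: na; apply: at_leastW.
  by apply: at_least_sub h => a' [].
move=> p /Gstep [d [pi [c [dD piP inf kinc]]]]; exists (restr c).
have [_ sX] := hX pi piP.
apply: sub_infinite_set inf => a /= [pia Ga]; exists (And p (inst d a)); split=> //.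
  by move=> b [].
move=> b [_ /lsat_inst dba]; exists (Th (d, pi)).
  apply: List.in_map; apply/List.in_prod_iff; rewrite hD in dD; split=> //.
  by rewrite hP in piP.
split; first by split; last exact/sX.
move=> [u [ui hu]]; apply: (kinc u ui) => [i|]; first by apply/sX; case: (hu i).
by exists b => i; case: (hu i).
Qed.

End FiniteParameters.

Lemma tiny_home (L : language) (M : structure L) (G : ctx (lsort (Leq M))) :
  tiny L (cvar G) -> tiny L (cvar (home G)).
Proof.
move=> tG; apply: tiny_embeds (tiny_prod tG (tiny_nat L)).
exists (fun w : cvar (home G) => (projT1 w, nat_of_ord (projT2 w))) => -[v i] [w j] [vw].
by subst w => /ord_inj ->.
Qed.

Lemma monster_compact (L : language) (T : theory L) (kappa : Type)
    (M : structure L) (G : ctx (lsort (Leq M))) :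
  monster_model T kappa M -> tiny L (cvar G) -> compact_in (Meq M) G.
Proof.
move=> [sk _ satM _] tG; apply: compact_Meq; apply: saturated_compact satM _.
exact: tiny_small sk (tiny_home tG).
Qed.

Lemma small_entries (L : language) (T : theory L) (kappa : Type)
    (M : structure L) (G : ctx (lsort (Leq M))) (a : asg (Meq M) G) :
  monster_model T kappa M -> tiny L (cvar G) -> small kappa (entries a).
Proof.
move=> [sk _ _ _] /(tiny_small sk) [Gk kG].
have aG : entries a #<= [set: cvar G] by apply: card_image_le.
split; first exact: card_le_trans aG Gk.
by move=> ka; apply: kG; apply: card_le_trans ka aG.
Qed.

Lemma tp_complete (L : language) (N : structure L) (x : fctx (lsort L))
    (b : asg N x) (A : set (elem N)) : complete_type A (tp b A).
Proof.
split; first split.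
- by move=> f [].
- by move=> F Ftp _; exists b => f /Ftp [].
move=> f fA; have [fb|nfb] := pselect (lsat f b); first by left.
right; split=> //; have [w [d [e [eA ->]]]] := fA.
by exists w, (Neg d), e.
Qed.

Lemma tp_sub (L : language) (N : structure L) (x : fctx (lsort L))
    (b : asg N x) (A B : set (elem N)) : A `<=` B -> tp b A `<=` tp b B.
Proof.
move=> AB f [[w [d [e [eA ->]]]] fb]; split=> //.
by exists w, d, e; split=> // v /eA /AB.
Qed.

Theorem theorem2p2p2 (L : language) (T : theory L) (kappa : Type)
  (M : structure L) (hM : monster_model T kappa M)
  (P : forall x : fctx (lsort (Leq M)), set (set (lformula (Meq M) x)))
  (hPtypes : forall (x : fctx (lsort (Leq M))) (p : set (lformula (Meq M) x)),
     P x p -> is_type kappa p)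
  (hTP : finitely_coordinatized P)
  (hProsy : forall (x : fctx (lsort (Leq M))) (p : set (lformula (Meq M) x)),
     P x p -> rosy_type kappa p) :
  rosy_theory M.
Proof.
move=> x y z Delta Pi k p fD fP; apply: contrapT => /rank_undefined_fixpoint.
move=> [G [Gp Gcons /(fixpoint_chain_data fD fP)]].
move=> [Qz [Thetas [fQz dTh bTh Gstep]]].
pose z0 := sub_ctx Qz; pose I := itree L.
pose V := chain_ctx y z0 I.
have tV : tiny L (cvar V).
  apply: tiny_prod (tiny_itree L) (tiny_sum (tiny_ord _ _) _).
  exact: finite_sub_tiny.
have cpt H : tiny L (cvar H) -> compact_in (Meq M) H := monster_compact hM.
have [||||b [E bE]] := @chain_exists _ (Meq M) x y z0 I (@below L) (@below_wf L)
    Thetas dTh [set S | exists2 q, G q & S = lsat q].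
- by move=> _ [q Gq ->]; have [b] := Gcons q Gq; exists b.
- move=> _ [q /Gstep [c inf] ->]; exists c; apply: sub_infinite_set inf => a.
  by move=> [q' [Gq' q'q hq']]; exists (lsat q'); split=> //; exists q'.
- by exists (lsat p), p.
- by apply: cpt; apply: tiny_sum (tiny_ord _ _) tV.
have [_ /(_ (existT _ x b)) [n [t [t0 tn tP]]]] := hTP.
(* [B m] includes t_m because the type of t_(m+1) over it has to extend the member of [P] over
   t_m. *)
pose B m := entries (cat_asg E (projT2 (t m))).
have BE m : entries E `<=` B m by move=> _ [v _ <-]; exists (inl v).
have Bt m : entries (projT2 (t m)) `<=` B m by move=> _ [v _ <-]; exists (inr v).
have /choice [B0 hB0] m : exists B0 : set (elem (Meq M)), [/\ B0 `<=` B m,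
    B0 #<= [set: all_formulas L] &
    m < n -> ~ type_thorn_forks (tp (projT2 (t m.+1)) (B m)) B0].
  have [mn|mn] := boolP (m < n); last by exists set0; split.
  have [|B0 [B0B cB0 nf]] := hProsy _ _ (tP m mn) (B m) (tp (projT2 (t m.+1)) (B m))
    _ (tp_complete _ _) (tp_sub (@Bt m)).
    by apply: small_entries hM _; apply: tiny_sum tV (tiny_ord _ _).
  by exists B0.
(* An element may occur at several indices; one of them is enough, since [D] has only to contain the
   element. Off the chain the value is arbitrary. *)
have /choice [g hg] (e : elem (Meq M)) : exists i : I, entries E e ->
    exists2 w : cvar V, w.1 = i & elem_of (E w) = e.
  have [[w _ we]|ne] := pselect (entries E e); first by exists w.1 => _; exists w.
  by exists (Leaf L).
have [j hj] : exists j : I, forall m e, B0 m e -> below (g e) j.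
  by apply: index_bound => m; have [] := hB0 m.
pose bv := base_vars (y := y) (z := z0) (@below L) j.
pose D := @chain_base _ (Meq M) y z0 I (@below L) E j.
pose alg (s : ftuple (Meq M)) := algebraic (chain_a E j) (projT2 s) D.
(* Here t_n is [b], and c_j is part of [D], so the bounded formula that relates b, a_j and c_j is of
   the required form. *)
have alg_n : alg (t n).
  rewrite tn; have [[Th ThT hTh] _] := bE j; have [l hl] := bTh Th ThT.
  have jb v : bv (j, inr v) by right; split=> //; exists v.
  pose c (d : asg (Meq M) (sub_ctx bv)) : asg (Meq M) z0 :=
    fun v => d (exist _ (j, inr v) (jb v)).
  pose th (e : asg (Meq M) (cat_ctx y (cat_ctx x (sub_ctx bv)))) :=
    Th (cat_asg (lasg (rasg e)) (cat_asg (lasg e) (c (rasg (rasg e))))).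
  exists th, l; split; last exact: hTh.
  split; last by move=> d; apply: hl.
  apply: definable_subst (dTh Th ThT); apply: is_subst_cat; first by auto.
  apply: is_subst_cat; first by auto.
  pose rr (e : asg (Meq M) (cat_ctx y (cat_ctx x (sub_ctx bv)))) :=
    rasg (rasg e).
  have srr : is_subst rr by rewrite /rr; auto.
  by move=> v; apply: (srr (exist _ (j, inr v) (jb v))).
have alg_step m : m < n -> alg (t m.+1) -> alg (t m).
  move=> mn; have [B0B _ /(_ mn) nf] := hB0 m.
  apply: (algebraic_descent _ _ _ _ nf).
  - apply: cpt; apply: tiny_sum; first exact: tiny_prod (tiny_nat L) (tiny_ord _ _).
    apply: tiny_sum (tiny_ord _ _) _; apply: tiny_embeds tV.
    by exists (@sval _ _); apply: sval_inj.
  (* A member of B0 comes from t_m or from the chain; in the latter case it occurs at an index below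
     [j], hence in [D]. *)
  - move=> e B0e; have [[v|v] _ ve] := B0B e B0e; last by left; exists v.
    right; have [|w wg we] := hg e; first by exists v.
    have bw : bv w by left; rewrite wg; apply: hj B0e.
    by exists (exist _ w bw).
  - by move=> e /entries_restr /BE.
  - by move=> _ [v _ <-]; apply: BE; exists (j, inl v).
have alg_all d : d <= n -> alg (t (n - d)).
  elim: d => [|d IH] dn; first by rewrite subn0.
  by apply: alg_step; rewrite ?subnSK //; [exact: leq_subr|apply/IH/ltnW].
(* As t_0 is the empty tuple, filling it into [th] yields one of the families excluded by
   [independent_at]. *)
have := alg_all n (leqnn n); rewrite subnn t0 => -[th [l [[dth bth] thE]]].
have [_ indep] := bE j.
pose o := asg0 (Meq M).
apply: (indep (fun E => ~ th (cat_asg (chain_a E j)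
  (cat_asg o (@chain_base _ (Meq M) y z0 I (@below L) E j))))) thE.
exists (fun e => th (cat_asg (lasg e) (cat_asg o (rasg e)))), l; split=> //.
split; last by move=> d; apply: (bth (cat_asg o d)).
apply: definable_subst dth; apply: is_subst_cat; first by auto.
by apply: is_subst_cat; [case|auto].
Qed.
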